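(* Let $n$ be an even positive integer, let $S=(\mathcal{K},\mathcal{X})$ be a supercharacter theory of $D_{2n}$ which is not characteristic, and let $\tau\in\mathrm{Aut}(D_{2n})$ be the automorphism which sends $s$ to $sr$ and fixes all rotations (powers of $r$). Then $S\vee S^\tau\in\mathcal{R}$, and $S=\psi_i(S\vee S^\tau)$ for some $i\in\{0,1\}$.
   Context: Supercharacter theories. A supercharacter theory of a finite group $G$ is a pair $S=(\mathcal{K},\mathcal{X})$, where $\mathcal{K}$ is a partition of $G$ into unions of conjugacy classes and $\mathcal{X}$ is a partition of $\mathrm{Irr}(G)$ (complex irreducible characters), such that $|\mathcal{K}|=|\mathcal{X}|$, $\{e\}\in\mathcal{K}$, and for each $X\in\mathcal{X}$ the character $\sigma_X=\sum_{\chi\in X}\chi(e)\chi$ is constant on each part of $\mathcal{K}$. The parts of $\mathcal{K}$ are the superclasses of $S$. $\mathrm{SCT}(G)$ is the set of supercharacter theories of $G$, partially ordered by $(\mathcal{K},\mathcal{X})\le(\mathcal{L},\mathcal{Y})$ if $\mathcal{K}$ refines $\mathcal{L}$ (equivalently, $\mathcal{X}$ refines $\mathcal{Y}$). It is a lattice, with join $(\mathcal{K},\mathcal{X})\vee(\mathcal{L},\mathcal{Y})=(\mathcal{K}\vee\mathcal{L},\mathcal{X}\vee\mathcal{Y})$ computed by joins of set partitions. For $\alpha\in\mathrm{Aut}(G)$ and $S=(\mathcal{K},\mathcal{X})$, let $S^\alpha=\alpha\cdot S=(\alpha\cdot\mathcal{K},\alpha\cdot\mathcal{X})$ with $\alpha\cdot\mathcal{K}=\{\alpha(K):K\in\mathcal{K}\}$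 and $\alpha\cdot\mathcal{X}=\{\{\chi\circ\alpha^{-1}:\chi\in X\}:X\in\mathcal{X}\}$; this is again a supercharacter theory. $S$ is characteristic if $\alpha\cdot S=S$ for all $\alpha\in\mathrm{Aut}(G)$; $\mathrm{CharSCT}(G)$ is the set of characteristic supercharacter theories. Dihedral groups. $D_{2n}=\langle r,s: r^n=s^2=e,\ srs=r^{-1}\rangle$, of order $2n$. For $n$ even, $\mu_0,\mu_1$ are the linear characters of $D_{2n}$ with $\mu_i(r^k)=(-1)^k$, $\mu_0(sr^k)=(-1)^k$, $\mu_1(sr^k)=-(-1)^k$. A supercharacter theory of $D_{2n}$ glues reflections if $s\langle r\rangle$ is a (possibly proper) subset of one of its superclasses. $\mathcal{R}$ is the set of those $S\in\mathrm{CharSCT}(D_{2n})$ which glue reflections and such that, for every superclass $K$ of $S$ consisting only of powers of $r$, the exponents of these powers all have the same parity. For $S=(\mathcal{K},\mathcal{X})\in\mathcal{R}$, write the superclass containing the reflections as $s\langle r\rangle\cup A\cup B$, where $A$ contains only even powers of $r$ and $B$ only odd powers of $r$ (one or both may be empty), and let $X\in\mathcal{X}$ be the part containing both $\mu_0$ and $\mu_1$. For $i=0,1$ define $\psi_i(S)=(\mathcal{L}_i,\mathcal{Y}_i)$ by \[ \mathcal{L}_0=\{s\langle r^2\rangle\cup A,\ sr\langle r^2\rangle\cup B\}\cup(\mathcal{K}\setminus\{s\langle r\rangle\cup A\cup B\}), \] \[ \mathcal{L}_1=\{s\langle r^2\rangle\cup B,\ sr\langle r^2\rangle\cup A\}\cup(\mathcal{K}\setminus\{s\langle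 r\rangle\cup A\cup B\}), \] \[ \mathcal{Y}_i=\{\{\mu_i\},\ X\setminus\{\mu_i\}\}\cup(\mathcal{X}\setminus\{X\}). \] Each $\psi_i(S)$ is a supercharacter theory of $D_{2n}$.
   Formalization: For n = 2 it is additionally assumed that S^τ ≠ S; this excludes only the theory with superclasses {e}, {r}, {s, sr} of D_4, which is not characteristic but is fixed by τ, so S∨S^τ = S is not in R and the claim fails. *)

(* Defs.v *)
From HB Require Import structures.
From mathcomp Require Import all_boot all_order all_algebra.
From mathcomp Require Import all_fingroup all_solvable all_field all_character.

Set Implicit Arguments.
Unset Strict Implicit.
Unset Printing Implicit Defensive.

Import GroupScope GRing.Theory.
Local Open Scope group_scope.

Section PartitionJoin.

Variable T : finType.

Definition share_block (P Q : {set {set T}}) : rel T :=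
  fun x y => [exists A in P :|: Q, (x \in A) && (y \in A)].

(* The join of two partitions of the same set: the classes of the equivalence
   relation generated by lying in a common block of P or of Q. *)
Definition partition_join (P Q : {set {set T}}) : {set {set T}} :=
  equivalence_partition (connect (share_block P Q)) (cover P).

End PartitionJoin.

Section Supercharacters.

Variables (gT : finGroupType) (G : {group gT}).

(* Irreducible characters are represented by their indices in Iirr G. *)
Definition sct_data : Type := ({set {set gT}} * {set {set Iirr G}})%type.

Definition sigma (Y : {set Iirr G}) : 'CF(G) :=
  (\sum_(i in Y) 'chi_i 1%g *: 'chi_i)%R.

Definition is_sct (S : sct_data) : Prop :=
  let: (K, X) := S in
  [/\ partition K G
      /\ (forall A, A \in K ->
            exists2 C : {set {set gT}}, C \subset classes G & A = cover C),
      partition X [set: Iirr G],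
      #|K| = #|X|,
      [set 1] \in K
    & forall Y, Y \in X -> forall A, A \in K -> {in A &, forall g h, sigma Y g = sigma Y h}].

Definition sct_join (S T : sct_data) : sct_data :=
  (partition_join S.1 T.1, partition_join S.2 T.2).

(* The image of Y under chi |-> chi \o a^-1, for a \in Aut G. *)
Definition act_chars (a : {perm gT}) (Y : {set Iirr G}) : {set Iirr G} :=
  [set j | [exists i in Y, [forall x in G, ('chi_j x == 'chi_i (a^-1%g x))%R]]].

Definition sct_act (a : {perm gT}) (S : sct_data) : sct_data :=
  ([set a @: A | A : {set gT} in S.1], [set act_chars a Y | Y : {set Iirr G} in S.2]).

Definition characteristic_sct (S : sct_data) : Prop :=
  forall a, a \in Aut G -> sct_act a S = S.

End Supercharacters.

Section Dihedral.

Variables (gT : finGroupType) (G : {group gT}).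

(* A group with generators satisfying the relations is a quotient of the
   presented group, which has order 2n; so the cardinality condition says that
   G is the presented group, with r and s its standard generators. *)
Definition dihedral_gens (n : nat) (r s : gT) : Prop :=
  [/\ G :=: <<[set r; s]>>, #|G| = n.*2, r ^+ n = 1, s ^+ 2 = 1 & s * r * s = r^-1].

(* For even n, the indices of the linear characters mu_0 and mu_1. *)
Definition is_mu (r s : gT) (mu : 'I_2 -> Iirr G) : Prop :=
  forall (i : 'I_2) (k : nat),
    ('chi_(mu i) (r ^+ k)%g = (-1) ^+ k)%R
    /\ ('chi_(mu i) (s * r ^+ k)%g = (-1) ^+ i * (-1) ^+ k)%R.

Definition glues_reflections (r s : gT) (S : sct_data G) : Prop :=
  exists2 A, A \in S.1 & s *: <[r]> \subset A.

Definition in_R (r s : gT) (S : sct_data G) : Prop :=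
  [/\ is_sct S,
      characteristic_sct S,
      glues_reflections r s S
    & forall A, A \in S.1 -> A \subset <[r]> ->
        forall k l, r ^+ k \in A -> r ^+ l \in A -> odd k = odd l].

(* Meaningful for n even and in_R r s S. Then mu_0 and mu_1 lie in the same part
   of S.2, so X below is the part containing both. *)
Definition psi (r s : gT) (mu : 'I_2 -> Iirr G) (i : 'I_2) (S : sct_data G) : sct_data G :=
  let K := pblock S.1 s in
  let A := K :&: <[r ^+ 2]> in
  let B := K :&: (r *: <[r ^+ 2]>) in
  let X := pblock S.2 (mu ord0) in
  let A' := if i == ord0 then A else B in
  let B' := if i == ord0 then B else A in
  ([set (s *: <[r ^+ 2]>) :|: A'; ((s * r) *: <[r ^+ 2]>) :|: B'] :|: (S.1 :\ K),
   [set [set mu i]; X :\ mu i] :|: (S.2 :\ X)).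

End Dihedral.

(* Main.v *)
(* The functions sigma_X span the space of functions constant on superclasses,
   so superclasses and parts determine each other, through the values
   sum_(g in K) chi(g) / chi(1), which are constant on parts and separate them.
   Galois conjugation of these functions shows that superclasses are permuted by
   g |-> g^j for j prime to |G|; hence for n > 2 a theory gluing reflections, or
   one in which reflections and rotations never share a superclass, is
   characteristic, as automorphisms act on rotations by such powers.

   If S is not characteristic, the superclasses of s and sr are therefore
   distinct, s<r^2> u A and sr<r^2> u B with rotations A, B, not both empty, and
   mu_0 and mu_1 lie in different parts. If both of these parts had another
   member, comparing the values above (all irreducible characters but the four
   linear ones vanish on reflections) would force either at least n/2 even
   nontrivial rotations or more than n/2 odd rotations in A u B. So some {mu_i} is a
   part; mu_i is then constant on superclasses, which gives the parity condition.
   Since tau swaps the two classes of reflections, and mu_0 and mu_1, and fixes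
   all rotations and all other characters, joining S with S^tau merges just the
   two superclasses of reflections and the two parts of mu_0 and mu_1. *)
Require Import Defs.
From HB Require Import structures.
From mathcomp Require Import all_boot all_order all_algebra.
From mathcomp Require Import all_fingroup all_solvable all_field all_character.
From mathcomp Require Import zify ring.

Set Implicit Arguments.
Unset Strict Implicit.
Unset Printing Implicit Defensive.

Import GroupScope GRing.Theory.
Local Open Scope group_scope.

(** * Partitions *)

Section Partitions.

Variable T : finType.
Implicit Types (P Q M : {set {set T}}) (A B C D : {set T}).

Lemma mem_pblockC P x y : trivIset P -> (x \in pblock P y) = (y \in pblock P x).
Proof.
move=> tiP; apply/idP/idP => H; rewrite (same_pblock tiP H) mem_pblock;
  by move: H; rewrite /pblock; case: pickP => [A /andP[PA ?] _|]; rewrite ?inE //;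
  apply/bigcupP; exists A.
Qed.

Lemma partition_sub P D A : partition P D -> A \in P -> A \subset D.
Proof. by move/cover_partition <-; apply: bigcup_sup. Qed.

Lemma partition_pblock P D x : partition P D -> x \in D -> pblock P x \in P.
Proof. by move/cover_partition <-; apply: pblock_mem. Qed.

Lemma partition_mem_pblock P D x : partition P D -> (x \in pblock P x) = (x \in D).
Proof. by move/cover_partition <-; apply: mem_pblock. Qed.

Lemma partition_def_pblock P D A x :
  partition P D -> A \in P -> x \in A -> pblock P x = A.
Proof. by case/and3P=> _ tiP _; apply: def_pblock. Qed.

Lemma partition_pickblock P D A :
  partition P D -> A \in P -> exists2 x, x \in A & pblock P x = A.
Proof.
move=> pP PA; have /set0Pn[x Ax] := partition_neq0 pP PA.
by exists x => //; apply: partition_def_pblock pP PA Ax.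
Qed.

(** The condition makes the image of each block a block, and as [f] is injective there are as many
    images as blocks. *)
Lemma imset_partition P D (f : T -> T) :
    partition P D -> injective f -> f @: D = D ->
    {in D &, forall x y, (y \in pblock P x) = (f y \in pblock P (f x))} ->
  [set f @: A | A : {set T} in P] = P.
Proof.
move=> pP injf fD fP; have [_ tiP _] := and3P pP.
have fDm x : x \in D -> f x \in D by move=> Dx; rewrite -fD imset_f.
apply/eqP; rewrite eqEcard card_imset ?leqnn ?andbT; last exact: imset_inj.
apply/subsetP=> _ /imsetP[A PA ->].
have [x Ax defA] := partition_pickblock pP PA.
have Dx: x \in D by apply: (subsetP (partition_sub pP PA)).
suffices ->: f @: A = pblock P (f x) by rewrite (partition_pblock pP) ?fDm.
apply/setP=> y; apply/imsetP/idP => [[z Az ->] | yfx].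
  by rewrite -fP ?defA // (subsetP (partition_sub pP PA)).
have Dy: y \in D.
  by apply: (subsetP (partition_sub pP _)) yfx; rewrite (partition_pblock pP) ?fDm.
move: Dy yfx; rewrite -{1}fD => /imsetP[z Dz ->]; rewrite -fP // defA => Az.
by exists z.
Qed.

(** The explicit form that the join of a theory with its image under tau will take, for superclasses
    and for parts. *)
Definition merge P A B := (A :|: B) |: (P :\ A :\ B).

Section Merge.

Variables (P : {set {set T}}) (D A B : {set T}).
Hypotheses (pP : partition P D) (PA : A \in P) (PB : B \in P) (neqAB : A != B).

Let PB' : B \in P :\ A. Proof. by rewrite !inE eq_sym neqAB. Qed.

Lemma merge_partition : partition (merge P A B) D.
Proof.
have pD2 := partitionD1 (partitionD1 pP PA) PB'.
have sAD := partition_sub pP PA; have sBD := partition_sub pP PB.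
rewrite /merge; have ->: D = (A :|: B) :|: (D :\: A :\: B).
  by rewrite setDDl -{1}(setID D (A :|: B)) (setIidPr _) // subUset sAD.
apply: partitionU1 => //.
  by have /set0Pn[x Ax] := partition_neq0 pP PA; apply/set0Pn; exists x; rewrite inE Ax.
by rewrite setDDl -setI_eq0 setDE setIC -setIA [_ :&: (A :|: B)]setIC setICr setI0.
Qed.

Lemma mergeU_notin : A :|: B \notin P :\ A :\ B.
Proof.
apply/negP; rewrite !inE => /and3P[_ nA PAB].
have [x Ax defA] := partition_pickblock pP PA.
by case/eqP: nA; rewrite -[RHS]defA (partition_def_pblock pP PAB) ?inE ?Ax.
Qed.

Lemma card_merge : #|merge P A B|.+1 = #|P|.
Proof.
by rewrite cardsU1 mergeU_notin (cardsD1 A P) PA (cardsD1 B (P :\ A)) PB'.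
Qed.

Lemma mem_merge C : (C \in merge P A B) =
  (C == A :|: B) || [&& C != A, C != B & C \in P].
Proof. by rewrite !inE andbCA. Qed.

Lemma pblock_mergeU x : x \in A :|: B -> pblock (merge P A B) x = A :|: B.
Proof. by apply: (partition_def_pblock merge_partition); rewrite setU11. Qed.

Lemma mergeD1U : merge P A B :\ (A :|: B) = P :\ A :\ B.
Proof. by rewrite /merge setU1K ?mergeU_notin. Qed.

Lemma same_merge x y :
  x \in D -> y \in pblock P x -> y \in pblock (merge P A B) x.
Proof.
move=> Dx yx; set C := pblock P x in yx.
have PC : C \in P by apply: partition_pblock pP Dx.
have Cx : x \in C by rewrite (partition_mem_pblock _ pP).
have [eA|nA] := eqVneq C A; first by rewrite pblock_mergeU inE -eA ?Cx ?yx.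
have [eB|nB] := eqVneq C B; first by rewrite pblock_mergeU inE -eB ?Cx ?yx ?orbT.
by rewrite (partition_def_pblock merge_partition (_ : C \in _) Cx) // mem_merge nA nB PC orbT.
Qed.

(** A block of Q that meets A and B connects their points; every other link stays inside a block of
    P or inside the union of A and B. *)
Lemma partition_join_merge Q :
    (forall C, C \in Q -> C \in P \/ C \subset A :|: B) ->
    (exists2 C, C \in Q & ~~ [disjoint C & A] && ~~ [disjoint C & B]) ->
  partition_join P Q = merge P A B.
Proof.
move=> QP [C0 QC0 /andP[/pred0Pn[a /andP[/= C0a Aa]] /pred0Pn[b /andP[/= C0b Bb]]]].
have pM := merge_partition; have [_ tiM _] := and3P pM.
have shareP C x y : C \in P -> x \in C -> y \in C -> connect (share_block P Q) x y.
  by move=> PC Cx Cy; apply/connect1/existsP; exists C; rewrite inE PC Cx Cy.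
have cab : connect (share_block P Q) a b.
  by apply/connect1/existsP; exists C0; rewrite inE QC0 C0a C0b orbT.
have cba : connect (share_block P Q) b a.
  by apply/connect1/existsP; exists C0; rewrite inE QC0 C0a C0b orbT.
rewrite /partition_join (cover_partition pP) -[RHS](equivalence_partition_pblock pM).
have stepM x y : x \in D -> share_block P Q x y -> y \in pblock (merge P A B) x.
  move=> Dx /existsP[C /and3P[PQC Cx Cy]].
  have [PC|sC] : C \in P \/ C \subset A :|: B.
    by move: PQC; rewrite inE => /orP[|/QP //]; left.
    by apply: same_merge; rewrite ?(partition_def_pblock pP PC Cx).
  by rewrite pblock_mergeU; apply: (subsetP sC).
have connM x y : x \in D -> connect (share_block P Q) x y = (y \in pblock (merge P A B) x).
  move=> Dx; apply/idP/idP => [/connectP[p pth ->] | ].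
    elim: p x Dx pth => [|z p IHp] x Dx /= => [_|/andP[xz pz]].
      by rewrite (partition_mem_pblock _ pM).
    have zx := stepM _ _ Dx xz; rewrite -(same_pblock tiM zx); apply: IHp => //.
    by apply: (subsetP (partition_sub pM _)) zx; rewrite (partition_pblock pM).
  have := partition_pblock pM Dx.
  have := partition_mem_pblock x pM; rewrite Dx; move: (pblock _ x) => C Cx.
  rewrite mem_merge => /orP[/eqP eC | /and3P[_ _ PC] Cy]; last exact: shareP Cx Cy.
  move: Cx; rewrite eC => /setUP[Ax|Bx] /setUP[Ay|By].
  - exact: shareP Ax Ay.
  - exact: connect_trans (shareP _ _ _ PA Ax Aa) (connect_trans cab (shareP _ _ _ PB Bb By)).
  - exact: connect_trans (shareP _ _ _ PB Bx Bb) (connect_trans cba (shareP _ _ _ PA Aa Ay)).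
  exact: shareP Bx By.
apply: eq_in_imset => x Dx; apply/setP => y; rewrite !inE.
by rewrite connM.
Qed.

End Merge.

End Partitions.

(** * Superclasses and parts *)

Section Duality.

Import Order.TTheory Num.Theory.

Variables (gT : finGroupType) (G : {group gT}).
Implicit Types (Y : {set Iirr G}) (A : {set gT}).
Local Open Scope ring_scope.

Lemma cfdot_sigma_irr Y i : '[sigma Y, 'chi_i] = (i \in Y)%:R * 'chi_i 1%g.
Proof.
rewrite /sigma cfdot_suml; case: (boolP (i \in Y)) => Yi.
  rewrite (bigD1 i) //= cfdotZl cfnorm_irr mulr1 mul1r big1 ?addr0 // => j /andP[_ ji].
  by rewrite cfdotZl cfdot_irr (negPf ji) mulr0.
rewrite mul0r big1 // => j Yj; rewrite cfdotZl cfdot_irr.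
by case: eqP Yi Yj => [->|]; rewrite ?mulr0 // => /negPf->.
Qed.

Lemma cfdot_irr_cfuni A i :
  A <| G -> '['chi_i, '1_A] = #|G|%:R^-1 * \sum_(g in A) 'chi[G]_i g.
Proof.
move=> nA; have /andP[sAG _] := nA.
rewrite cfdotE; congr (_ * _).
rewrite (bigID (mem A)) /= [X in _ + X]big1 ?addr0 => [|x /andP[_ /negPf nAx]].
  rewrite (eq_bigl (fun x => x \in A)) => [|x].
    by apply: eq_bigr => x Ax; rewrite cfuniE // Ax rmorph1 mulr1.
  by rewrite andbC; case: (boolP (x \in A)) => //= /(subsetP sAG) ->.
by rewrite cfuniE // nAx rmorph0 mulr0.
Qed.

Variables (K : {set {set gT}}) (X : {set {set Iirr G}}).
Hypothesis hS : is_sct (K, X).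

Let pK : partition K G. Proof. by case: hS => [[]]. Qed.
Let pX : partition X [set: Iirr G]. Proof. by case: hS. Qed.

(** Here [<|] is applied to a mere set: stability under conjugation makes ['1_A] the true indicator
    function of A. *)
Lemma sct_normal A : A \in K -> A <| G.
Proof.
case: hS => [[_ cK] _ _ _ _] KA; rewrite /normal (partition_sub pK KA).
have [C /subsetP sC ->] := cK A KA.
apply/subsetP=> g Gg; rewrite inE; apply/subsetP=> _ /imsetP[x /bigcupP[B CB Bx] ->].
apply/bigcupP; exists B => //.
have /imsetP[y Gy defB] := sC B CB; move: Bx; rewrite defB => Bx.
by rewrite -(class_eqP Bx) memJ_class.
Qed.

Lemma sct_sigma_const Y x y :
  Y \in X -> x \in G -> y \in pblock K x -> sigma Y x = sigma Y y.
Proof.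
case: hS => [_ _ _ _ cS] XY Gx yx.
by apply: (cS Y XY (pblock K x)); rewrite ?(partition_pblock pK) ?(partition_mem_pblock _ pK).
Qed.

Lemma sigma_cfuni Y :
  Y \in X -> sigma Y = \sum_(A in K) sigma Y (repr A) *: '1_A.
Proof.
move=> XY; apply/cfun_inP=> x Gx; rewrite [RHS]sum_cfunE.
have Kx := partition_pblock pK Gx.
have xx : x \in pblock K x by rewrite (partition_mem_pblock _ pK).
rewrite (bigD1 (pblock K x)) //= big1 => [|A /andP[KA nA]].
  rewrite addr0 cfunE cfuniE ?sct_normal // xx mulr1.
  by apply: sct_sigma_const => //; apply: mem_repr xx.
rewrite cfunE cfuniE ?sct_normal //; case: (boolP (x \in A)) => [Ax|_]; last by rewrite mulr0.
by rewrite (partition_def_pblock pK KA Ax) eqxx in nA.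
Qed.

Lemma cfdot_sigma Y Z :
  Y \in X -> Z \in X -> Y != Z -> '[sigma Y, sigma Z] = 0.
Proof.
move=> XY XZ nYZ; rewrite {2}/sigma cfdot_sumr big1 // => i Zi.
rewrite cfdotZr cfdot_sigma_irr; case: (boolP (i \in Y)) => [Yi|_]; last by rewrite mul0r mulr0.
by case/eqP: nYZ; rewrite -(partition_def_pblock pX XY Yi) (partition_def_pblock pX XZ Zi).
Qed.

Lemma sigma_neq0 Y : Y \in X -> sigma Y != 0.
Proof.
move=> XY; have /set0Pn[i Yi] := partition_neq0 pX XY.
apply: contraTneq (irr1_neq0 i) => Y0; have := cfdot_sigma_irr Y i.
by rewrite Y0 cfdot0l Yi mul1r => <-; rewrite eqxx.
Qed.

(* The sigma_Y are |X| = |K| independent functions in the span of the '1_A. *)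
Lemma cfuni_sigma A :
  A \in K -> exists c, '1_A = \sum_(Y in X) c Y *: sigma Y.
Proof.
move=> KA; pose sX := [seq sigma Y | Y <- enum X].
pose sK := [seq '1_B : 'CF(G) | B <- enum K].
have fX : free sX.
  apply/orthogonal_free/pairwise_orthogonalP; split=> /=.
    rewrite map_inj_in_uniq ?enum_uniq ?andbT.
      by apply/mapP=> [[Y]]; rewrite mem_enum => /sigma_neq0/eqP nY /esym.
    move=> Y Z; rewrite !mem_enum => XY XZ eYZ; apply/eqP/idPn => nYZ.
    have := cfdot_sigma XY XZ nYZ; rewrite -eYZ => /eqP; rewrite cfnorm_eq0.
    by rewrite (negPf (sigma_neq0 XY)).
  move=> _ _ /mapP[Y + ->] /mapP[Z + ->]; rewrite !mem_enum => XY XZ nYZ.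
  by apply: cfdot_sigma => //; apply: contraNneq nYZ => ->.
have sXK : (<<sX>> <= <<sK>>)%VS.
  apply/span_subvP=> _ /mapP[Y + ->]; rewrite mem_enum => XY.
  rewrite sigma_cfuni //; apply: memv_suml => B KB; apply/memvZ/memv_span.
  by apply: map_f; rewrite mem_enum.
have eXK : <<sX>>%VS = <<sK>>%VS.
  apply/eqP; rewrite eqEdim sXK (leq_trans (dim_span _)) //.
  move: fX; rewrite /free => /eqP ->; rewrite !size_map -!cardE.
  by case: hS => _ _ -> _ _.
have : '1_A \in <<sX>>%VS by rewrite eXK memv_span // map_f ?mem_enum.
rewrite span_def big_map big_enum => /memv_sumP[v hv ->].
have hc Y : exists c, Y \in X -> v Y = c *: sigma Y.
  have [XY|] := boolP (Y \in X); last by exists 0.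
  by have /vlineP[c ->] := hv Y XY; exists c.
have [c hc'] := fin_all_exists hc; exists c.
by apply: eq_bigr => Y XY; rewrite hc'.
Qed.

(** For a union A of classes, this is the scalar by which the sum of A in the group algebra acts on
    a module affording ['chi_i]. *)
Definition block_value (A : {set gT}) (i : Iirr G) : algC :=
  (\sum_(g in A) 'chi_i g) / 'chi_i 1%g.

(** Expand ['1_A] in the [sigma Y]. Its inner product with ['chi_k] is the conjugate of the
    coefficient at the part of k, times the degree; dividing by the degree leaves a number that
    depends on the part alone. *)
Lemma block_value_const A i j :
  A \in K -> j \in pblock X i -> block_value A i = block_value A j.
Proof.
move=> KA ij; have [c eA] := cfuni_sigma KA.
have Xi : pblock X i \in X by rewrite (partition_pblock pX) ?inE.
have {}Xi k : k \in pblock X i -> #|G|%:R^-1 * block_value A k = (c (pblock X i))^*.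
  move=> ik; apply: (mulIf (irr1_neq0 k)).
  rewrite -mulrA divfK ?irr1_neq0 // -cfdot_irr_cfuni ?sct_normal // eA.
  rewrite cfdot_sumr (bigD1 (pblock X i)) //= cfdotZr cfdotC cfdot_sigma_irr ik mul1r.
  rewrite (conj_natr (Cnat_irr1 k)) big1 ?addr0 // => Z /andP[XZ nZ].
  rewrite cfdotZr cfdotC cfdot_sigma_irr; case: (boolP (k \in Z)) => [Zk|_].
    by case/eqP: nZ; rewrite -(partition_def_pblock pX XZ Zk) (partition_def_pblock pX Xi ik).
  by rewrite mul0r rmorph0 mulr0.
apply: (mulfI (invr_neq0 (neq0CG G))).
by rewrite !Xi // (partition_mem_pblock _ pX) inE.
Qed.

(** The inner product of ['chi_k] with the sigma of the part of i, over the degree, is 1 if k lies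
    in that part and 0 if not. Sigma being constant on superclasses, this number is a combination of
    the values of superclasses at k. *)
Lemma block_value_sep i j :
  (forall A, A \in K -> block_value A i = block_value A j) -> j \in pblock X i.
Proof.
move=> eij; have Xi : pblock X i \in X by rewrite (partition_pblock pX) ?inE.
have dotE k : '['chi_k, sigma (pblock X i)] / 'chi_k 1%g =
    \sum_(A in K) (sigma (pblock X i) (repr A))^* * (#|G|%:R^-1 * block_value A k).
  rewrite {1}(sigma_cfuni Xi) cfdot_sumr mulr_suml; apply: eq_bigr => A KA.
  by rewrite cfdotZr cfdot_irr_cfuni ?sct_normal // !mulrA.
have : '['chi_i, sigma (pblock X i)] / 'chi_i 1%g = '['chi_j, sigma (pblock X i)] / 'chi_j 1%g.
  by rewrite !dotE; apply: eq_bigr => A KA; rewrite eij.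
rewrite cfdotC cfdot_sigma_irr [X in _ = X / _]cfdotC cfdot_sigma_irr.
rewrite (partition_mem_pblock _ pX) inE mul1r (conj_natr (Cnat_irr1 i)).
rewrite divff ?irr1_neq0 //; case: (j \in _) => // /eqP.
by rewrite mul0r rmorph0 mul0r oner_eq0.
Qed.

(** The indicator function of the superclass of x is a combination of the [sigma Y], so it agrees at
    x and y. *)
Lemma sigma_sep x y :
    x \in G -> y \in G -> (forall Y, Y \in X -> sigma Y x = sigma Y y) ->
  y \in pblock K x.
Proof.
move=> Gx Gy exy; have Kx := partition_pblock pK Gx; have [c eA] := cfuni_sigma Kx.
have : ('1_(pblock K x) : 'CF(G)) x = ('1_(pblock K x) : 'CF(G)) y.
  by rewrite eA !sum_cfunE; apply: eq_bigr => Y XY; rewrite !cfunE exy.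
rewrite !cfuniE ?sct_normal // (partition_mem_pblock _ pK) Gx.
by case: (y \in _) => // /eqP; rewrite oner_eq0.
Qed.

Lemma class_pblock x g : x \in G -> g \in G -> (x ^ g)%g \in pblock K x.
Proof.
move=> Gx Gg; have /andP[_ /subsetP nKx] := sct_normal (partition_pblock pK Gx).
by rewrite memJ_norm ?nKx // (partition_mem_pblock _ pK).
Qed.

(** * Galois conjugation and power maps *)

Lemma irr_Galois j :
  coprime j #|G| ->
  exists u : {rmorphism algC -> algC},
    forall i x, x \in G -> u ('chi[G]_i x) = 'chi_i (x ^+ j)%g.
Proof.
case/Qn_aut_exists=> u hu; exists u => i x Gx.
have [Hx Hxj] : x \in <[x]>%g /\ (x ^+ j)%g \in <[x]>%g by rewrite cycle_id mem_cycle.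
have sH : <[x]>%g \subset G by rewrite cycle_subG.
rewrite -!(cfResE 'chi_i sH) //.
(* On the cyclic group of x the character is a sum of linear ones, whose values are roots of unity
   of order dividing |G|; [u] raises these to the power j. *)
have /char_sum_irr[r ->] := cfRes_char <[x]> (irr_char i).
rewrite !sum_cfunE rmorph_sum; apply: eq_bigr => k _.
have lin_k : 'chi_k \is a linear_char.
  by apply/char_abelianP; apply: cycle_abelian.
rewrite lin_charX // hu // -lin_charX //.
have /eqP-> : (x ^+ #|G|)%g == 1%g by rewrite -order_dvdn order_dvdG.
exact: lin_char1.
Qed.

Lemma pblock_expg j x y :
    coprime j #|G| -> x \in G -> y \in pblock K x ->
  (y ^+ j)%g \in pblock K (x ^+ j)%g.
Proof.
move=> co_j Gx yx; have [u hu] := irr_Galois co_j.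
have Gy : y \in G.
  by apply: (subsetP (partition_sub pK _)) yx; rewrite (partition_pblock pK).
apply: sigma_sep; rewrite ?groupX // => Y XY.
have uE z : z \in G -> u (sigma Y z) = sigma Y (z ^+ j)%g.
  move=> Gz; rewrite /sigma !sum_cfunE rmorph_sum; apply: eq_bigr => i _.
  (* The degree is the value at 1, and 1^j = 1, so [u] fixes it. *)
  by rewrite !cfunE rmorphM hu // hu // expg1n.
by rewrite -!uE // (sct_sigma_const XY Gx yx).
Qed.

(** * Automorphisms acting on a theory *)

Lemma Aut_mem (a : {perm gT}) x : a \in Aut G -> (a x \in G) = (x \in G).
Proof. by rewrite inE => /andP[/perm_closed-> _]. Qed.

(** Preserving superclasses is enough: their values do not change when [a] acts on superclass and
    character together, and these values determine the parts. *)
Lemma sct_act_fixed (a : {perm gT}) :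
    a \in Aut G ->
    {in G &, forall x y, (y \in pblock K x) = (a y \in pblock K (a x))} ->
  sct_act a (K, X) = (K, X).
Proof.
move=> AutGa ha.
have isoa : isom G G (autm AutGa) by apply/isomP; rewrite injm_autm im_autm.
have aK : [set a @: A | A : {set gT} in K] = K.
  apply: (imset_partition pK) => //; first exact: perm_inj.
  by rewrite -[RHS](im_autm AutGa) morphimEdom; apply: eq_imset => x; rewrite /= autmE.
pose f := isom_Iirr isoa; have injf : injective f := isom_Iirr_inj isoa.
have fE i x : x \in G -> 'chi_(f i) (a x) = 'chi_i x.
  by move=> Gx; rewrite /f isom_IirrE -(autmE AutGa) cfIsomE.
have act_f Y : act_chars a Y = f @: Y.
  apply/setP=> j; rewrite inE; apply/existsP/imsetP => [[i /andP[Yi /forallP ej]]|[i Yi ->]].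
    exists i => //; apply: irr_inj; apply/cfun_inP => x Gx.
    have /eqP -> := implyP (ej x) Gx.
    by rewrite -[in RHS](permKV a x) fE // Aut_mem ?groupV.
  exists i; rewrite Yi; apply/forallP=> x; apply/implyP=> Gx.
  by rewrite -[in 'chi_(f i) x](permKV a x) fE // Aut_mem ?groupV.
rewrite /sct_act /= aK; congr pair; rewrite (eq_imset _ act_f).
have valE A i : A \in K -> block_value (a @: A) (f i) = block_value A i.
  move=> KA; have sAG := subsetP (partition_sub pK KA).
  rewrite /block_value big_imset /=; last by move=> ? ? _ _; apply: perm_inj.
  have {1}<- : a 1%g = 1%g by rewrite -(autmE AutGa) morph1.
  by rewrite fE //; congr (_ / _); apply: eq_bigr => x Ax; rewrite fE ?sAG.
apply: (imset_partition pX) => //.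
  by apply/eqP; rewrite eqEcard subsetT card_imset ?leqnn.
move=> i j _ _; apply/idP/idP => ij; apply: block_value_sep => A KA.
  by move: KA; rewrite -aK => /imsetP[B KB ->]; rewrite !valE // (block_value_const KB ij).
rewrite -(valE A i KA) -(valE A j KA); apply: block_value_const ij.
by rewrite -aK imset_f.
Qed.

Lemma sct_characteristic :
    (forall a, a \in Aut G ->
       {in G &, forall x y, y \in pblock K x -> a y \in pblock K (a x)}) ->
  characteristic_sct (K, X).
Proof.
move=> ha a AutGa; apply: sct_act_fixed => // x y Gx Gy; apply/idP/idP; first exact: ha.
by move/(ha _ (groupVr AutGa)); rewrite !permK; apply; rewrite Aut_mem.
Qed.

End Duality.

(** * Dihedral groups *)

Section Dihedral.

Import Order.TTheory Num.Theory.

Variables (n : nat) (gT : finGroupType) (G : {group gT}) (r s : gT).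
Hypotheses (n_gt0 : (0 < n)%N) (hG : dihedral_gens G n r s).

Lemma dihedral_mem_r : r \in G.
Proof. by case: hG => -> *; rewrite mem_gen ?set21. Qed.

Lemma dihedral_mem_s : s \in G.
Proof. by case: hG => -> *; rewrite mem_gen ?set22. Qed.

Let Gr := dihedral_mem_r.
Let Gs := dihedral_mem_s.

Lemma dihedral_sV : s^-1 = s.
Proof. by case: hG => _ _ _ s2 _; apply: (mulgI s); rewrite mulgV -expg2. Qed.

Lemma dihedral_rJs : r ^ s = r^-1.
Proof. by case: hG => _ _ _ _ srs; rewrite conjgE dihedral_sV mulgA. Qed.

Lemma dihedral_cycle_sub : <[r]> \subset G.
Proof. by rewrite cycle_subG. Qed.

Let sRG x : x \in <[r]> -> x \in G.
Proof. exact: (subsetP dihedral_cycle_sub). Qed.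

Lemma dihedral_mulE : G :=: <[r]> * <[s]>.
Proof.
rewrite -norm_joinEr; first by case: hG => -> *; rewrite joing_idl joing_idr.
by rewrite norms_cycle dihedral_rJs groupV cycle_id.
Qed.

(** G is the product of the cyclic groups of r and s, of orders at most n and 2, so |G| = 2n forces
    order n for r. *)
Lemma dihedral_order_r : #[r] = n.
Proof.
case: hG => _ cardG rn s2 _; have := mul_cardG <[r]> <[s]>.
rewrite -dihedral_mulE cardG -!orderE => eqc.
have le_r : #[r] <= n by rewrite dvdn_leq // order_dvdn rn.
have le_s : #[s] <= 2 by rewrite dvdn_leq // order_dvdn s2.
apply/eqP; rewrite eqn_leq le_r leqNgt; apply/negP => lt_r.
have : (n.*2 <= #[r] * #[s])%N by rewrite eqc leq_pmulr ?cardG_gt0.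
by rewrite leqNgt (leq_ltn_trans (leq_mul (leqnn _) le_s)) // muln2 ltn_double.
Qed.

Lemma dihedral_cases x :
  x \in G -> (exists k, x = r ^+ k) \/ (exists k, x = s * r ^+ k).
Proof.
rewrite dihedral_mulE => /mulsgP[_ _ /cycleP[i ->] /cycleP[j ->] ->].
have [_ _ _ s2 _] := hG.
rewrite -[j]odd_double_half -mul2n expgD expgM s2 expg1n mulg1.
case: (odd j); last by left; exists i; rewrite mulg1.
(* r^i s = s r^-i, with [n.-1] as the exponent -1. *)
right; exists (n.-1 * i)%N; rewrite expgM expg1; apply: (mulgI s^-1).
rewrite -conjgE conjXg dihedral_rJs mulKg; congr (_ ^+ i).
apply: (mulgI r); rewrite mulgV -expgS prednK //.
by case: hG.
Qed.

Lemma dihedral_s_notin : s \notin <[r]>.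
Proof.
apply/negP=> rs; have [_ cardG _ _ _] := hG.
have := cardG; rewrite dihedral_mulE (mulGSid _) ?cycle_subG // -orderE dihedral_order_r.
by move/eqP; rewrite -addnn -[X in X == _]addn0 eqn_add2l eq_sym -leqn0 leqNgt n_gt0.
Qed.

Lemma dihedral_refl_notin k : s * r ^+ k \notin <[r]>.
Proof. by rewrite groupMr ?mem_cycle // dihedral_s_notin. Qed.

Lemma dihedral_refl x : x \in G -> x \notin <[r]> -> exists k, x = s * r ^+ k.
Proof. by case/dihedral_cases=> // [[k ->]]; rewrite mem_cycle. Qed.

Lemma dihedral_inv x y : x \in G -> x \notin <[r]> -> y \in <[r]> -> y ^ x = y^-1.
Proof.
move=> Gx /(dihedral_refl Gx)[k ->] /cycleP[l ->].
have c : commute (r^-1 ^+ l) (r ^+ k) by apply/commuteX2/commute_sym/commuteV.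
by rewrite conjgM conjXg dihedral_rJs conjgE c mulKg expVgn.
Qed.

Lemma dihedral_reflX x j : x \in G -> x \notin <[r]> -> odd j -> x ^+ j = x.
Proof.
move=> Gx nx oj; suffices x2 : x ^+ 2 = 1.
  by rewrite -[j]odd_double_half oj -mul2n expgD expgM x2 expg1n mulg1.
have [k defx] := dihedral_refl Gx nx; have [_ _ _ s2 _] := hG.
rewrite expg2 {1}defx -mulgA [r ^+ k * x]conjgC.
by rewrite dihedral_inv ?mem_cycle // defx -!mulgA mulgV mulg1 -expg2.
Qed.

(* Automorphisms preserve <r> once n > 2: an element outside has order 2. *)
Lemma dihedral_Aut (a : {perm gT}) :
    2 < n -> ~~ odd n -> a \in Aut G ->
  exists j, [/\ coprime j #|G|, {in <[r]>, forall x, a x = x ^+ j}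
              & {in G, forall x, x \notin <[r]> -> a x \notin <[r]>}].
Proof.
move=> n_gt2 n_even AutGa.
have aX x k : x \in G -> a (x ^+ k) = a x ^+ k.
  by move=> Gx; rewrite -(autmE AutGa) morphX.
have oa x : x \in G -> #[a x] = #[x].
  by move=> Gx; rewrite -(autmE AutGa) order_injm ?injm_autm.
have Gar : a r \in G by rewrite Aut_mem.
have Rar : a r \in <[r]>.
  (* Outside the rotations the image of r would square to 1, but it has order n. *)
  apply: contraLR n_gt2 => nar; rewrite -leqNgt -dihedral_order_r -oa //.
  rewrite dvdn_leq // order_dvdn -(inj_eq (mulIg (a r))) mul1g -expgSr.
  by rewrite dihedral_reflX.
have /cycleP[j ej] := Rar.
have co_jn : coprime n j.
  rewrite -dihedral_order_r -generator_coprime /generator -ej eq_sym eqEcard.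
  by rewrite cycle_subG Rar -!orderE (oa r Gr) leqnn.
have co_j : coprime j #|G|.
  have [_ -> _ _ _] := hG; rewrite -muln2 coprimeMr coprime_sym co_jn coprimen2 -coprime2n.
  by apply: coprime_dvdl co_jn; rewrite dvdn2.
have aR x : x \in <[r]> -> a x = x ^+ j.
  by case/cycleP=> k ->; rewrite aX // ej -!expgM mulnC.
exists j; split=> // x Gx nx; apply: contra nx => rax.
have : a x \in a @: <[r]>.
  suffices ->: a @: <[r]> = <[r]> by [].
  apply/eqP; rewrite eqEcard card_imset ?leqnn ?andbT; last exact: perm_inj.
  by apply/subsetP=> _ /imsetP[y Ry ->]; rewrite aR ?groupX.
by rewrite mem_imset //; apply: perm_inj.
Qed.

(** * The characters mu_0 and mu_1, and all characters on reflections *)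

Hypothesis n_even : ~~ odd n.
Variable mu : 'I_2 -> Iirr G.
Hypothesis hmu : is_mu r s mu.

Notation c0 := (mu ord0).
Notation c1 := (mu ord_max).

Lemma mu_lin i : ('chi_(mu i) \is a linear_char)%R.
Proof.
rewrite qualifE/= irr_char; have := (hmu i 0).1; rewrite expg0 expr0 => ->.
exact: eqxx.
Qed.

Lemma mu1 i : ('chi_(mu i) 1%g = 1)%R.
Proof. exact: lin_char1 (mu_lin i). Qed.

(* mu_i is +1 or -1 on G; the two signs tell apart the four cosets of <r^2>. *)
Definition is1 (i : 'I_2) (x : gT) := ('chi_(mu i) x == 1)%R.

Let sign_eq1 (b : bool) : ((-1) ^+ b == 1 :> algC)%R = ~~ b.
Proof. by case: b; rewrite ?eqxx //= eq_sym -addr_eq0 (pnatr_eq0 _ 2). Qed.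

Lemma is1_rot i k : is1 i (r ^+ k) = ~~ odd k.
Proof. by rewrite /is1 (hmu i k).1 -signr_odd sign_eq1. Qed.

Lemma is1_refl i k : is1 i (s * r ^+ k) = ~~ (odd i (+) odd k).
Proof.
rewrite /is1 (hmu i k).2 -signr_odd -[((-1) ^+ k)%R]signr_odd.
by rewrite -signr_addb sign_eq1.
Qed.

Lemma mu_is1 i x : x \in G -> ('chi_(mu i) x = (-1) ^+ (~~ is1 i x))%R.
Proof.
case/dihedral_cases=> [] [k ->].
  by rewrite is1_rot negbK (hmu i k).1 signr_odd.
rewrite is1_refl negbK (hmu i k).2 signr_addb.
by rewrite -signr_odd -[((-1) ^+ k)%R]signr_odd.
Qed.

Lemma mem_cycle_is1 x : x \in G -> (x \in <[r]>) = (is1 ord0 x == is1 ord_max x).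
Proof.
case/dihedral_cases=> [] [k ->]; first by rewrite mem_cycle !is1_rot eqxx.
by rewrite (negPf (dihedral_refl_notin _)) !is1_refl; case: (odd k).
Qed.

Let sEr x : x \in <[r ^+ 2]> -> x \in <[r]>.
Proof. by apply/subsetP; rewrite cycle_subG mem_cycle. Qed.

(** Parity of the exponent is well defined, because mu_0 reads it off from the element. *)
Lemma even_rotE k : (r ^+ k \in <[r ^+ 2]>) = ~~ odd k.
Proof.
apply/idP/idP=> [/cycleP[l ekl] | ek].
  by rewrite -(is1_rot ord0) ekl -expgM is1_rot mul2n odd_double.
by rewrite -[k]odd_double_half (negPf ek) add0n -mul2n expgM mem_cycle.
Qed.

Let even_rotVE k : (r^-1 * r ^+ k \in <[r ^+ 2]>) = odd k.
Proof.
have ->: r^-1 = r ^+ n.-1.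
  apply: (mulgI r); rewrite mulgV -expgS prednK //.
  by case: hG.
have on : odd n.-1 by move: n_even; rewrite -{1}(prednK n_gt0) /= negbK.
by rewrite -expgD even_rotE oddD on negbK.
Qed.

Lemma mem_even_rot x :
  x \in G -> (x \in <[r ^+ 2]>) = is1 ord0 x && is1 ord_max x.
Proof.
case/dihedral_cases=> [] [k ->]; first by rewrite even_rotE !is1_rot andbb.
rewrite !is1_refl (negPf (contra (@sEr _) (dihedral_refl_notin _))).
by case: (odd k).
Qed.

Lemma mem_odd_rot x :
  x \in G -> (x \in r *: <[r ^+ 2]>) = ~~ is1 ord0 x && ~~ is1 ord_max x.
Proof.
rewrite mem_lcoset; case/dihedral_cases=> [] [k ->].
  by rewrite even_rotVE !is1_rot negbK andbb.
rewrite !is1_refl (negPf (contra (@sEr _) _)); first by case: (odd k).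
by rewrite groupMl ?groupV ?cycle_id // dihedral_refl_notin.
Qed.

Lemma mem_refl0 x :
  x \in G -> (x \in s *: <[r ^+ 2]>) = is1 ord0 x && ~~ is1 ord_max x.
Proof.
rewrite mem_lcoset dihedral_sV; case/dihedral_cases=> [] [k ->].
  rewrite (negPf (contra (@sEr _) (dihedral_refl_notin _))) !is1_rot.
  by case: (odd k).
by rewrite -{1}dihedral_sV mulKg even_rotE !is1_refl; case: (odd k).
Qed.

Lemma mem_refl1 x :
  x \in G -> (x \in (s * r) *: <[r ^+ 2]>) = ~~ is1 ord0 x && is1 ord_max x.
Proof.
rewrite mem_lcoset invMg dihedral_sV -mulgA; case/dihedral_cases=> [] [k ->].
  rewrite (negPf (contra (@sEr _) _)) ?is1_rot; first by case: (odd k).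
  by rewrite groupMl ?groupV ?cycle_id // dihedral_refl_notin.
by rewrite -{1}dihedral_sV mulKg even_rotVE !is1_refl; case: (odd k).
Qed.

Lemma card_even_rot : #|<[r ^+ 2]>| = n./2.
Proof.
by rewrite -orderE orderXdiv dihedral_order_r ?dvdn2 // divn2.
Qed.

(** The quotient of x and y is an even rotation r^2k, and conjugating x by r^k multiplies it by
    r^2k, as x inverts rotations. *)
Lemma refl_conj x y :
    x \in G -> y \in G -> x \notin <[r]> -> y \notin <[r]> ->
  is1 ord0 x = is1 ord0 y -> exists2 g, g \in G & y = x ^ g.
Proof.
move=> Gx Gy nx ny exy.
have : x^-1 * y \in <[r ^+ 2]>.
  rewrite mem_even_rot ?groupM ?groupV // /is1 !lin_charM ?mu_lin ?groupV //.
  rewrite !lin_charV ?mu_lin // !mu_is1 // exy.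
  have -> : is1 ord_max x = is1 ord_max y.
    by move: nx ny; rewrite !mem_cycle_is1 // exy; do 3!case: is1.
  by rewrite !mulVf ?signr_eq0 ?eqxx.
case/cycleP=> k exk; exists (r ^+ k); first by rewrite groupX.
rewrite -[y](mulKVg x) exk -expgM mulnC expgM expg2 conjgE.
by rewrite [RHS]mulgA [_^-1 * x]conjgC conjVg dihedral_inv ?mem_cycle // invgK mulgA.
Qed.

(** The fourth linear character: 1 on rotations, -1 on reflections. *)
Lemma mu_mul_irr :
  exists d : Iirr G, forall x, ('chi_d x = 'chi_c0 x * 'chi_c1 x)%R.
Proof.
have /irrP[d ed] := mul_lin_irr (mu_lin ord0) (mem_irr c1).
by exists d => x; rewrite -ed cfunE.
Qed.

Lemma is1_neq x : x \in G -> x \notin <[r]> -> is1 ord_max x = ~~ is1 ord0 x.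
Proof. by move=> Gx; rewrite mem_cycle_is1 //; do 2!case: is1. Qed.

(* The four linear characters already account for |C_G(x)| <= 4 in the column
   orthogonality relation. *)
Lemma irr_refl0 (d i : Iirr G) x :
    (forall y, ('chi_d y = 'chi_c0 y * 'chi_c1 y)%R) ->
    x \in G -> x \notin <[r]> -> i != 0%R -> i != d -> i != c0 -> i != c1 ->
  ('chi_i x = 0)%R.
Proof.
move=> ed Gx nx i0 id ic0 ic1.
(* The class of x contains its coset modulo even rotations, hence at least n/2 of the 2n
   elements. *)
have cent4 : #|'C_G[x]| <= 4.
  have sxE : x *: <[r ^+ 2]> \subset x ^: G.
    apply/subsetP=> y; rewrite mem_lcoset => Ey; have Ry := sEr Ey.
    have Gy : y \in G by rewrite -(groupMl _ (groupVr Gx)) sRG.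
    have ny : y \notin <[r]>.
      by apply: contra nx => ry; rewrite -groupV -(groupMr _ ry).
    have [|g Gg ->] := refl_conj Gx Gy nx ny; last exact: memJ_class.
    move: Ey; rewrite mem_even_rot ?(sRG Ry) // => /andP[/eqP e0 _].
    by rewrite /is1 -[in RHS](mulKVg x y) lin_charM ?mu_lin ?(sRG Ry) // e0 mulr1.
  have := subset_leq_card sxE; rewrite card_lcoset card_even_rot -index_cent1 => le_m.
  have := Lagrange (subcent1_sub x G); have [_ -> _ _ _] := hG => eL.
  have m_gt0 : 0 < n./2 by move: n_gt0; rewrite -{1}(even_halfK n_even) double_gt0.
  rewrite -(leq_pmul2r m_gt0) (leq_trans (leq_mul (leqnn _) le_m)) // eL.
  by rewrite -{1}(even_halfK n_even) -!muln2 -mulnA mulnC.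
have := second_orthogonality_relation x Gx; rewrite class_refl mulr1n.
have nzmu : ('chi_c0 r = -1)%R /\ ('chi_c1 r = -1)%R.
  by have := (hmu ord0 1%N).1; have := (hmu ord_max 1%N).1; rewrite !expg1 !expr1.
have N1 : (-1 == 1 :> algC)%R = false := sign_eq1 true.
have [e0 e1] : ('chi[G]_0 x = 1)%R /\ ('chi[G]_0 r = 1)%R.
  by rewrite irr0 !cfun1E Gx Gr.
have dr : ('chi_d r = 1)%R by rewrite ed nzmu.1 nzmu.2 mulrNN mulr1.
have c0x := mu_is1 ord0 Gx; have := mu_is1 ord_max Gx; rewrite is1_neq // => c1x.
have dx : ('chi_d x = -1)%R by rewrite ed c0x c1x; case: is1; rewrite ?mulr1 ?mul1r.
(* The values at r and x tell the four linear characters apart. *)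
have nd0 : d != 0%R by apply: contraFneq N1 => d0; rewrite -dx d0 e0.
have n00 : c0 != 0%R by apply: contraFneq N1 => d0; rewrite -nzmu.1 d0 e1.
have n10 : c1 != 0%R by apply: contraFneq N1 => d0; rewrite -nzmu.2 d0 e1.
have n0d : c0 != d by apply: contraFneq N1 => d0; rewrite -nzmu.1 d0 dr.
have n1d : c1 != d by apply: contraFneq N1 => d0; rewrite -nzmu.2 d0 dr.
have n10' : c1 != c0.
  apply: contraFneq N1 => d0; move: c0x; rewrite -d0 c1x.
  by move/eqP; case: is1; rewrite /= expr0 expr1 // eq_sym.
rewrite (bigD1 0%R) //= (bigD1 d) //= (bigD1 c0) ?n00 //= (bigD1 c1) ?n10 ?n1d //=.
rewrite (bigD1 i) /=; last first.
  by rewrite i0 id ic0 ic1.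
rewrite e0 dx c0x c1x !rmorph_sign /= rmorph1 rmorphN1 -!signr_addb !addbb !expr0 mulrNN !mulr1.
(* The linear characters contribute 4 already and [S] is nonnegative, so nothing is left for
   ['chi_i]. *)
set S := (\sum_(_ | _) _)%R => eS.
have S0 : (0 <= S)%R by apply: sumr_ge0 => j _; apply: mul_conjC_ge0.
have e4 : (4%:R = 1 + (1 + (1 + 1)) :> algC)%R.
  by rewrite -[4%N]/(1 + (1 + (1 + 1)))%N !natrD.
have le0 : ('chi_i x * ('chi_i x)^* + S <= 0)%R.
  by rewrite -(lerD2l 4%:R%R) addr0 {1}e4 -!addrA eS ler_nat.
apply/eqP; rewrite -mul_conjC_eq0 eq_le mul_conjC_ge0 andbT.
by apply: le_trans le0; rewrite lerDl.
Qed.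

Lemma irr_refl i x y :
    x \in G -> y \in G -> x \notin <[r]> -> y \notin <[r]> -> i != c0 -> i != c1 ->
  ('chi_i x = 'chi_i y)%R.
Proof.
move=> Gx Gy nx ny ic0 ic1; have [d ed] := mu_mul_irr.
have [-> | i0] := eqVneq i 0%R; first by rewrite irr0 !cfun1E Gx Gy.
have [-> | id] := eqVneq i d.
  by rewrite !ed !mu_is1 // !is1_neq //; do 2!case: is1; rewrite /= ?mulr1 ?mul1r.
by rewrite !(irr_refl0 ed).
Qed.

Lemma mu_neq : c0 != c1.
Proof.
have N1 : (-1 == 1 :> algC)%R = false := sign_eq1 true.
apply: contraFneq N1 => d0.
have := (hmu ord0 0%N).2; have := (hmu ord_max 0%N).2; rewrite d0 => ->.
by rewrite /= !expr0 !expr1 => /eqP; rewrite !mulr1.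
Qed.

(** On reflections mu_0 and mu_1 are opposite, so together they cancel in sigma; every other
    character takes a single value there. *)
Lemma sigma_refl (Y : {set Iirr G}) x y :
    x \in G -> y \in G -> x \notin <[r]> -> y \notin <[r]> ->
    (c0 \in Y) = (c1 \in Y) ->
  sigma Y x = sigma Y y.
Proof.
move=> Gx Gy nx ny eY; rewrite /sigma !sum_cfunE.
have [Yc0|nYc0] := boolP (c0 \in Y); last first.
  apply: eq_bigr => i Yi; rewrite !cfunE (irr_refl Gx Gy) //.
    by apply: contraTneq Yi => ->.
  by apply: contraTneq Yi => ->; rewrite -eY.
have Yc1 : c1 \in Y by rewrite -eY.
have mu0 z : z \in G -> z \notin <[r]> -> ('chi_c0 z + 'chi_c1 z = 0)%R.
  move=> Gz nz; rewrite !mu_is1 // is1_neq //; case: is1; by rewrite ?subrr ?addNr.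
have E z : z \in G -> z \notin <[r]> ->
    (\sum_(i in Y) ('chi_i 1%g *: 'chi_i) z =
     \sum_(i in Y | (i != c0) && (i != c1)) 'chi_i 1%g * 'chi_i z)%R.
  move=> Gz nz; rewrite (bigD1 c0) //= (bigD1 c1) /=; last by rewrite Yc1 eq_sym mu_neq.
  rewrite !cfunE !mu1 !mul1r addrA mu0 // add0r.
  by apply: eq_big => i; rewrite ?andbA // cfunE.
rewrite !E //; apply: eq_bigr => i /and3P[_ i0 i1].
by rewrite (irr_refl Gx Gy).
Qed.

Lemma ord2_neq (i j : 'I_2) : (i != j) = (j == rev_ord i).
Proof. by case: i j => [[|[|//]] ?] [[|[|//]] ?]; rewrite -!val_eqE. Qed.

Lemma ord2P (i : 'I_2) : i = ord0 \/ i = ord_max.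
Proof. by case: i => [[|[|//]] ?]; [left | right]; apply: val_inj. Qed.

Lemma rev_ord_ord0 : rev_ord ord0 = ord_max :> 'I_2. Proof. exact: val_inj. Qed.

Lemma rev_ord_ordmax : rev_ord ord_max = ord0 :> 'I_2. Proof. exact: val_inj. Qed.

Lemma mem_refl (i : 'I_2) x :
  x \in G -> (x \in (s * r ^+ i) *: <[r ^+ 2]>) = (x \notin <[r]>) && is1 i x.
Proof.
move=> Gx; rewrite mem_cycle_is1 //; case: (ord2P i) => ->.
  by rewrite mulg1 mem_refl0 //; do 2!case: is1.
by rewrite expg1 mem_refl1 //; do 2!case: is1.
Qed.

Lemma is1_rev i x : x \in G -> x \notin <[r]> -> is1 (rev_ord i) x = ~~ is1 i x.
Proof.
move=> Gx nx; have := is1_neq Gx nx; case: (ord2P i) => ->.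
  by rewrite (_ : rev_ord ord0 = ord_max) //; apply: val_inj.
by rewrite (_ : rev_ord ord_max = ord0) ?negbK; [move=> ->; rewrite negbK | apply: val_inj].
Qed.

(** Representatives s and sr of the two classes of reflections, numbered so that mu_i is 1 on the
    class of [refl i]. *)
Notation refl i := (s * r ^+ nat_of_ord (i : 'I_2)).

Lemma refl_mem (i : 'I_2) : refl i \in G.
Proof. by rewrite groupM ?groupX. Qed.

Lemma is1_reflE (i j : 'I_2) : is1 j (refl i) = (i == j).
Proof.
by rewrite is1_refl -val_eqE /=; case: (ord2P i) (ord2P j) => -> [] ->.
Qed.

(** * Values of a set containing exactly one class of reflections *)

Section Blocks.

Variables (A : {set gT}) (i : 'I_2).
Hypothesis sAG : A \subset G.
Hypothesis reflA : {in G, forall x, x \notin <[r]> -> (x \in A) = is1 i x}.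

Let e := #|A :&: <[r ^+ 2]>|.
Let o := #|(A :&: <[r]>) :\: <[r ^+ 2]>|.

Lemma block_sum k c :
    {in G, forall x, x \notin <[r]> -> is1 i x -> 'chi_k x = c}%R ->
  (\sum_(g in A) 'chi[G]_k g = \sum_(g in A :&: <[r]>) 'chi_k g + n./2%:R * c)%R.
Proof.
move=> hc; rewrite (big_setID <[r]>) /=; congr (_ + _)%R.
have eqA : A :\: <[r]> = (refl i) *: <[r ^+ 2]>.
  apply/setP=> x; rewrite inE; case: (boolP (x \in G)) => Gx.
    rewrite mem_refl //; case: (boolP (x \in <[r]>)) => //= nx.
    by rewrite reflA.
  apply/andP/idP => [[_ /(subsetP sAG)]|]; first by rewrite (negPf Gx).
  by rewrite mem_lcoset => /sEr/sRG; rewrite groupMl ?groupV ?refl_mem // (negPf Gx).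
rewrite eqA (eq_bigr (fun=> c)); last first.
  move=> x; rewrite -eqA inE => /andP[nx Ax]; have Gx := subsetP sAG x Ax.
  by rewrite hc // -reflA.
by rewrite sumr_const card_lcoset card_even_rot mulr_natl.
Qed.

Let sER : <[r ^+ 2]> \subset <[r]>. Proof. by rewrite cycle_subG mem_cycle. Qed.

Lemma rot_sum k c :
    {in <[r]>, forall x, 'chi_k x = if x \in <[r ^+ 2]> then 1 else c}%R ->
  (\sum_(g in A :&: <[r]>) 'chi[G]_k g = e%:R + o%:R * c)%R.
Proof.
move=> hc; rewrite (big_setID <[r ^+ 2]>) /=; congr (_ + _)%R.
  rewrite -setIA (setIidPr sER) (eq_bigr (fun=> 1%R)).
    by rewrite sumr_const.
  by move=> x /setIP[_ Ex]; rewrite hc ?Ex // sEr.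
rewrite (eq_bigr (fun=> c)) ?sumr_const ?mulr_natl // => x.
by rewrite !inE => /and3P[/negPf nE _ Rx]; rewrite hc // nE.
Qed.

Let eoE : #|A :&: <[r]>| = (e + o)%N.
Proof.
by rewrite -(cardsID <[r ^+ 2]> (A :&: _)) -setIA (setIidPr sER).
Qed.

(** Even rotations count 1 and odd ones -1; each of the n/2 reflections counts 1 if i = j and -1
    otherwise. The form as a difference of naturals prepares the passage to [nat]. *)
Lemma block_value_mu (j : 'I_2) :
  block_value A (mu j) =
  (if i == j then (e + n./2)%:R - o%:R else e%:R - (o + n./2)%:R)%R.
Proof.
rewrite /block_value mu1 divr1 (block_sum (c := ((-1) ^+ (i != j))%R)).
  rewrite (rot_sum (c := (-1)%R)); last first.
    move=> x Rx; have Gx := sRG Rx; rewrite mu_is1 // mem_even_rot //.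
    move: Rx; rewrite mem_cycle_is1 // => /eqP e01; rewrite -e01 andbb.
    by case: (ord2P j) => ->; rewrite -?e01; case: is1.
  rewrite mulrN1; case: eqP => _; rewrite ?natrD ?opprD /= ?expr0 ?expr1.
    by rewrite mulr1 addrAC.
  by rewrite mulrN1 addrA.
move=> x Gx nx ix; rewrite mu_is1 //; case: eqP => [<-|/eqP]; first by rewrite ix.
by rewrite ord2_neq => /eqP ->; rewrite is1_rev // ix.
Qed.

Lemma block_value_0 : @block_value gT G A 0%R = (e + o + n./2)%:R%R.
Proof.
rewrite /block_value irr0 cfun11 divr1 -irr0 (block_sum (c := 1%R)).
  rewrite (rot_sum (c := 1%R)) ?mulr1 ?natrD //.
  by move=> x Rx; rewrite irr0 cfun1E sRG //; case: ifP.
by move=> x Gx _ _; rewrite irr0 cfun1E Gx.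
Qed.

(** Only rotations contribute, each at most the degree in absolute value. *)
Lemma block_value_norm k :
    {in G, forall x, x \notin <[r]> -> is1 i x -> 'chi_k x = 0}%R ->
  (`|@block_value gT G A k| <= (e + o)%:R)%R.
Proof.
move=> hk; rewrite /block_value (block_sum hk) mulr0 addr0.
have k1 : (0 < 'chi_k 1%g)%R by apply: irr1_gt0.
rewrite normf_div (gtr0_norm k1) ler_pdivrMr // -eoE.
apply: le_trans (ler_norm_sum _ _ _) _.
rewrite -sumr_const mulr_suml; apply: ler_sum => x _; rewrite mul1r.
by apply: char1_ge_norm; apply: irr_char.
Qed.

Variable d : Iirr G.
Hypothesis ed : forall x, ('chi_d x = 'chi_c0 x * 'chi_c1 x)%R.

Lemma block_value_d : (block_value A d = (e + o)%:R - n./2%:R)%R.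
Proof.
have dE x : x \in G -> ('chi_d x = (-1) ^+ (x \notin <[r]>))%R.
  by move=> Gx; rewrite ed !mu_is1 // mem_cycle_is1 // -signr_addb; do 2!case: is1.
rewrite /block_value dE // group1 expr0 divr1 (block_sum (c := (-1)%R)).
  rewrite (rot_sum (c := 1%R)) ?mulr1 ?natrD ?mulrN1 //.
  by move=> x Rx; rewrite dE ?sRG // Rx expr0; case: ifP.
by move=> x Gx nx _; rewrite dE // nx.
Qed.

End Blocks.

(** * Supercharacter theories of dihedral groups *)

Section Superclasses.

Variables (K : {set {set gT}}) (X : {set {set Iirr G}}).
Hypothesis hS : is_sct (K, X).

Let pK : partition K G. Proof. by case: hS => [[]]. Qed.
Let pX : partition X [set: Iirr G]. Proof. by case: hS. Qed.
Let tiK : trivIset K. Proof. by case/and3P: pK. Qed.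
Let tiX : trivIset X. Proof. by case/and3P: pX. Qed.

Lemma refl_pblock x y :
    x \in G -> y \in G -> x \notin <[r]> -> y \notin <[r]> ->
  is1 ord0 x = is1 ord0 y -> y \in pblock K x.
Proof.
by move=> Gx Gy nx ny /(refl_conj Gx Gy nx ny)[g Gg ->]; apply: (class_pblock hS).
Qed.

Lemma is1_same i x y :
    x \in G -> y \in G -> x \notin <[r]> -> y \notin <[r]> ->
  (is1 i x == is1 i y) = (is1 ord0 x == is1 ord0 y).
Proof.
move=> Gx Gy nx ny; case: (ord2P i) => -> //; rewrite !is1_neq //.
by do 2!case: is1.
Qed.

(** Superclasses are closed under conjugation, so one that meets both classes of reflections
    contains them. *)
Lemma glued_refl u v :
    u \in G -> v \in G -> u \notin <[r]> -> v \notin <[r]> ->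
    v \in pblock K u -> is1 ord0 u != is1 ord0 v ->
  {in G &, forall x y, x \notin <[r]> -> y \notin <[r]> -> y \in pblock K x}.
Proof.
move=> Gu Gv nu nv vu nuv x y Gx Gy nx ny.
have S0 : {in G, forall z, z \notin <[r]> -> z \in pblock K u}.
  move=> z Gz nz; have [uz|nuz] := eqVneq (is1 ord0 u) (is1 ord0 z).
    exact: refl_pblock.
  rewrite -(same_pblock tiK vu); apply: refl_pblock => //.
  by move: nuv nuz; do 3!case: is1.
by rewrite (same_pblock tiK (S0 x Gx nx)) S0.
Qed.

(* Off <r> everything lies in one superclass, so an automorphism acts on
   superclasses as a power map. *)
Lemma glued_characteristic :
    2 < n -> {in G &, forall x y, x \notin <[r]> -> y \notin <[r]> -> y \in pblock K x} ->
  characteristic_sct (K, X).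
Proof.
move=> n_gt2 gl; apply: (sct_characteristic hS) => a AutGa x y Gx Gy yx.
have [j [co_j aR aS]] := dihedral_Aut n_gt2 n_even AutGa.
(* G has even order, so j is odd and the j-th power fixes every reflection. *)
have oj : odd j.
  have [_ cG _ _ _] := hG; move: co_j; rewrite cG -muln2 coprimeMr => /andP[_].
  by rewrite coprimen2.
have aX z : z \in G -> a z \in pblock K (z ^+ j).
  move=> Gz; case: (boolP (z \in <[r]>)) => [Rz|nz].
    by rewrite aR // (partition_mem_pblock _ pK) groupX.
  by rewrite dihedral_reflX //; apply: gl; rewrite ?(Aut_mem _ AutGa) ?aS.
rewrite (same_pblock tiK (aX x Gx)) -(same_pblock tiK (pblock_expg hS co_j Gx yx)).
exact: aX.
Qed.

(* Superclasses of reflections that contain no rotation are conjugacy classes. *)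
Lemma unmixed_characteristic :
    2 < n -> {in G &, forall x y, x \notin <[r]> -> y \in pblock K x -> y \notin <[r]>} ->
    {in G &, forall x y, x \notin <[r]> -> y \notin <[r]> -> y \in pblock K x ->
       is1 ord0 x = is1 ord0 y} ->
  characteristic_sct (K, X).
Proof.
move=> n_gt2 um ngl; apply: (sct_characteristic hS) => a AutGa x y Gx Gy yx.
have [j [co_j aR aS]] := dihedral_Aut n_gt2 n_even AutGa.
have [Rx|nx] := boolP (x \in <[r]>).
  have Ry : y \in <[r]>.
    apply: contraLR Rx => ny; apply: (um _ _ Gy Gx ny).
    by rewrite mem_pblockC.
  by rewrite !aR // (pblock_expg hS).
have ny := um _ _ Gx Gy nx yx.
have [g Gg ->] := refl_conj Gx Gy nx ny (ngl _ _ Gx Gy nx ny yx).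
by rewrite -(autmE AutGa) morphJ //= autmE; apply: (class_pblock hS); rewrite Aut_mem.
Qed.

(** * Theories that separate the two classes of reflections *)

Section Unglued.

Hypothesis unglued :
  {in G &, forall x y, x \notin <[r]> -> y \notin <[r]> -> y \in pblock K x ->
     is1 ord0 x = is1 ord0 y}.

Notation L i := (pblock K (refl i)).

Lemma block_refl (i : 'I_2) : L i \in K.
Proof. by rewrite (partition_pblock pK) ?refl_mem. Qed.

Lemma block_reflS (i : 'I_2) : L i \subset G.
Proof. exact: partition_sub pK (block_refl i). Qed.

Lemma block_reflE (i : 'I_2) :
  {in G, forall x, x \notin <[r]> -> (x \in L i) = is1 i x}.
Proof.
move=> x Gx nx; have Gi := refl_mem i; have ni := dihedral_refl_notin i.
have e1 : is1 i (refl i) by rewrite is1_reflE.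
have e2 : is1 i x = (is1 ord0 (refl i) == is1 ord0 x).
  by rewrite -(is1_same i Gi Gx ni nx) e1.
apply/idP/idP => [xi | ix].
  by rewrite e2 (unglued Gi Gx ni nx xi) eqxx.
by move: ix; rewrite e2 => /eqP; apply: refl_pblock.
Qed.

Lemma block_refl_id (i : 'I_2) : refl i \in L i.
Proof. by rewrite (partition_mem_pblock _ pK) refl_mem. Qed.

Lemma block_reflD (i j : 'I_2) : i != j -> [disjoint L i & L j].
Proof.
move=> nij; have /and3P[_ /trivIsetP tK _] := pK; apply: tK; rewrite ?block_refl //.
apply: contra nij => /eqP eL; have := block_refl_id i.
by rewrite eL block_reflE ?refl_mem ?dihedral_refl_notin // is1_reflE.
Qed.

Lemma block_refl1 (i : 'I_2) : 1 \notin L i.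
Proof.
apply/negP=> L1; have K1 : [set 1] \in K by case: hS.
have := block_refl_id i; rewrite -(partition_def_pblock pK (block_refl i) L1).
rewrite (partition_def_pblock pK K1 (set11 _)) inE => /eqP e1.
by have := dihedral_refl_notin i; rewrite e1 group1.
Qed.

(** If mu_0 and mu_1 shared a part, every [sigma Y] would involve both or neither, hence agree at s
    and sr, and these would share a superclass. *)
Lemma mu_separated : c1 \notin pblock X c0.
Proof.
apply/negP=> c01; have [Gi ni] := (refl_mem, dihedral_refl_notin).
have : refl ord_max \in pblock K (refl ord0).
  apply: (sigma_sep hS) => // Y XY; apply: sigma_refl => //.
  apply/idP/idP=> Yc; first by rewrite -(partition_def_pblock pX XY Yc).
  by rewrite -(partition_def_pblock pX XY Yc) mem_pblockC.
move=> h; have := unglued (Gi ord0) (Gi ord_max) (ni _) (ni _) h.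
by rewrite !is1_reflE.
Qed.

Lemma mu_separated2 (i j : 'I_2) : i != j -> mu j \notin pblock X (mu i).
Proof.
move=> nij; have := mu_separated; case: (ord2P i) nij => ->; case: (ord2P j) => -> //.
by rewrite mem_pblockC.
Qed.

Let e i := #|L i :&: <[r ^+ 2]>|.
Let o i := #|(L i :&: <[r]>) :\: <[r ^+ 2]>|.

Let natr_eqB (a b c d : nat) : (a%:R - b%:R = c%:R - d%:R :> algC)%R -> (a + d = c + b)%N.
Proof.
move=> h; apply/eqP; rewrite -(eqr_nat algC) !natrD -subr_eq0.
have -> : (a%:R + d%:R - (c%:R + b%:R) = a%:R - b%:R - (c%:R - d%:R) :> algC)%R by ring.
by rewrite h subrr.
Qed.

Let natr_normB (a b c : nat) :
  (`|a%:R - b%:R : algC| <= c%:R)%R -> (a <= b + c)%N /\ (b <= a + c)%N.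
Proof.
move=> h; have h' : (`|b%:R - a%:R : algC| <= c%:R)%R by rewrite distrC.
have aux (x y : nat) : (`|x%:R - y%:R : algC| <= c%:R)%R -> (x <= y + c)%N.
  move=> hxy; rewrite -(ler_nat algC) natrD -lerBlDl; apply: le_trans hxy.
  by apply: real_ler_norm; rewrite rpredB ?realn.
by split; apply: aux.
Qed.

(* The values of the superclasses of s and sr at mu_i and at any other member
   of the part of mu_i agree. *)
Lemma part_bound (i : 'I_2) k :
    k \in pblock X (mu i) -> k != mu i ->
  n./2 <= o i /\ o (rev_ord i) = 0%N \/
  n./2 <= (o i).*2 /\ n./2 <= (e (rev_ord i)).*2.
Proof.
move=> Xk nk; have [d ed] := mu_mul_irr.
have nii : i != rev_ord i by rewrite ord2_neq.
have E1 := block_value_const hS (block_refl i) Xk.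
have E2 := block_value_const hS (block_refl (rev_ord i)) Xk.
rewrite !(block_value_mu (block_reflS _) (@block_reflE _)) eqxx -/(e i) -/(o i) in E1 E2.
rewrite eq_sym (negPf nii) -/(e _) -/(o _) in E2.
have m_gt0 : 0 < n./2 by move: n_gt0; rewrite -{1}(even_halfK n_even) double_gt0.
(* At the trivial character [E2] would equate -(o + n/2) with o + n/2, for o = [o (rev_ord i)]. *)
have [k0|k0] := eqVneq k 0%R.
  move: E2; rewrite k0 (block_value_0 (block_reflS _) (@block_reflE _)).
  rewrite -/(e _) -/(o _) -[X in _ = X]subr0 => /(@natr_eqB _ _ _ 0) h.
  by move: m_gt0 h; clear; move: (e _) (o _) n./2; lia.
(* At [d], [E1] gives [o i] = n/2 and [E2] gives [o (rev_ord i)] = 0. *)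
have [kd|kd] := eqVneq k d.
  left; move: E1 E2; rewrite kd !(block_value_d (block_reflS _) (@block_reflE _) ed).
  rewrite -/(e i) -/(o i) -/(e (rev_ord i)) -/(o (rev_ord i)) => /natr_eqB h1 /natr_eqB.
  by move: h1; clear; move: (e _) (o _) (e _) (o _) n./2; lia.
have kmu j : k != mu j.
  have [<- //|nij] := eqVneq i j.
  by apply: contraTneq Xk => ->; apply: mu_separated2.
(* The remaining characters vanish on reflections, so the number of rotations in the superclass
   bounds their values. *)
right; have hk x : x \in G -> x \notin <[r]> -> ('chi_k x = 0)%R.
  by move=> Gx nx; apply: (irr_refl0 ed).
have := block_value_norm (block_reflS i) (@block_reflE i) (fun x Gx nx _ => hk x Gx nx).
have := block_value_norm (block_reflS (rev_ord i)) (@block_reflE _) (fun x Gx nx _ => hk x Gx nx).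
rewrite -E1 -E2 -/(e i) -/(o i) -/(e (rev_ord i)) -/(o (rev_ord i)).
move=> /natr_normB[_ h1] /natr_normB[h2 _].
by move: h1 h2; clear; move: (e _) (o _) (e _) (o _) n./2; lia.
Qed.

(** Otherwise [part_bound] applies to both parts. Its first alternative for i makes [o (rev_ord i)]
    zero, while both alternatives for [rev_ord i] make it positive; the second alternative for both
    gives at least n/2 even rotations in the two superclasses. *)
Lemma part_mu : exists i, pblock X (mu i) = [set mu i].
Proof.
have sub1 i : mu i \in pblock X (mu i) by rewrite (partition_mem_pblock _ pX).
have [e0|n0] := eqVneq (pblock X c0) [set c0]; first by exists ord0.
have [e1|n1] := eqVneq (pblock X c1) [set c1]; first by exists ord_max.
have pick i : pblock X (mu i) != [set mu i] ->
    exists2 k, k \in pblock X (mu i) & k != mu i.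
  rewrite eqEsubset sub1set sub1 andbT => /subsetPn[k Xk]; rewrite inE.
  by exists k.
have [k0 X0 nk0] := pick _ n0; have [k1 X1 nk1] := pick _ n1.
have b0 := part_bound X0 nk0; have b1 := part_bound X1 nk1.
have r0 : rev_ord ord0 = ord_max :> 'I_2 by apply: val_inj.
have r1 : rev_ord ord_max = ord0 :> 'I_2 by apply: val_inj.
rewrite r0 in b0; rewrite r1 in b1.
have m_gt0 : 0 < n./2 by move: n_gt0; rewrite -{1}(even_halfK n_even) double_gt0.
have card2 (A B C : {set gT}) :
    [disjoint A & B] -> A \subset C -> B \subset C -> #|A| + #|B| <= #|C|.
  move=> dAB sA sB; rewrite -cardsUI (disjoint_setI0 dAB) cards0 addn0.
  by rewrite subset_leq_card // subUset sA.
have dL : [disjoint L ord0 & L ord_max] by apply: block_reflD.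
have dL2 (A B : {set gT}) :
    A \subset L ord0 -> B \subset L ord_max -> [disjoint A & B].
  by move=> sA sB; apply: disjointWl sA (disjointWr sB dL).
(* Strict, as the identity is an even rotation outside both superclasses. *)
have le_e : (e ord0 + e ord_max < n./2)%N.
  rewrite -card_even_rot (cardsD1 1 <[r ^+ 2]>) group1 ltnS.
  have sE i : L i :&: <[r ^+ 2]> \subset <[r ^+ 2]> :\ 1.
    by rewrite subsetD1 subsetIr inE (negPf (block_refl1 i)).
  by apply: card2; rewrite ?sE // dL2 // subsetIl.
have le_o : (o ord0 + o ord_max <= n./2)%N.
  have -> : n./2 = #|<[r]> :\: <[r ^+ 2]>|.
    rewrite cardsD (setIidPr _) ?cycle_subG ?mem_cycle // card_even_rot.
    by rewrite -orderE dihedral_order_r -{2}(even_halfK n_even) -addnn addnK.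
  apply: card2; rewrite ?setSD ?subsetIr //.
  by apply: dL2; apply: subset_trans (subsetDl _ _) (subsetIl _ _).
by move: m_gt0 le_e le_o b0 b1; clear; move: (e _) (o _) (e _) (o _) n./2; lia.
Qed.

End Unglued.

End Superclasses.

(** * The join with the image under tau *)

Section Tau.

Variable tau : {perm gT}.
Hypotheses (htau : tau \in Aut G) (htau_s : tau s = s * r).
Hypothesis htau_r : forall x, x \in <[r]> -> tau x = x.

Let Gtau x : (tau x \in G) = (x \in G).
Proof. exact: Aut_mem. Qed.

Lemma tau_refl x :
    x \in G -> x \notin <[r]> ->
  tau x \notin <[r]> /\ is1 ord0 (tau x) = ~~ is1 ord0 x.
Proof.
move=> Gx /(dihedral_refl Gx)[k ->].
have -> : tau (s * r ^+ k) = s * r ^+ k.+1.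
  rewrite -(autmE htau) morphM ?groupX //= autmE htau_s htau_r ?mem_cycle //.
  by rewrite -mulgA -expgS.
by rewrite dihedral_refl_notin !is1_refl.
Qed.

(** On characters tau acts as the transposition of mu_0 and mu_1, the others being constant on
    reflections. *)
Lemma irr_tau k x :
  x \in G -> ('chi_(tperm c0 c1 k) (tau x) = 'chi_k x)%R.
Proof.
move=> Gx; have [Rx|nx] := boolP (x \in <[r]>).
  rewrite htau_r //; have /cycleP[l ->] := Rx.
  by case: tpermP => // ->; rewrite (hmu _ l).1 (hmu _ l).1.
have [nt et] := tau_refl Gx nx; have Gt : tau x \in G by rewrite Gtau.
case: tpermP => [->|->|/eqP k0 /eqP k1].
- by rewrite !mu_is1 // is1_neq // et negbK.
- by rewrite !mu_is1 // et is1_neq.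
exact: irr_refl.
Qed.

Lemma mem_act_chars_tau (Y : {set Iirr G}) j :
  (j \in act_chars tau Y) = (tperm c0 c1 j \in Y).
Proof.
rewrite inE; apply/existsP/idP => [[i /andP[Yi /forallP h]] | Yj].
  suffices -> : tperm c0 c1 j = i by [].
  apply/irr_inj/cfun_inP => x Gx; rewrite -irr_tau // tpermK.
  have := h (tau x); rewrite Gtau Gx permK; exact: eqP.
exists (tperm c0 c1 j); rewrite Yj; apply/forallP=> x; apply/implyP=> Gx.
have Gx' : tau^-1 x \in G by rewrite -Gtau permKV.
by rewrite -(irr_tau _ Gx') permKV tpermK.
Qed.

(** * A theory and its image under tau *)

Section Blocks.

Variables (K : {set {set gT}}) (X : {set {set Iirr G}}).
Hypothesis hS : is_sct (K, X).

Let pK : partition K G. Proof. by case: hS => [[]]. Qed.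
Let pX : partition X [set: Iirr G]. Proof. by case: hS. Qed.
Let tiK : trivIset K. Proof. by case/and3P: pK. Qed.
Let tiX : trivIset X. Proof. by case/and3P: pX. Qed.

(** Each element stays in its superclass under tau. Unlike [glued_characteristic], this covers n =
    2. *)
Lemma glued_tau :
    {in G &, forall x y, x \notin <[r]> -> y \notin <[r]> -> y \in pblock K x} ->
  sct_act tau (K, X) = (K, X).
Proof.
move=> gl; apply: (sct_act_fixed hS) => // x y Gx Gy.
have st z : z \in G -> tau z \in pblock K z.
  move=> Gz; have [Rz|nz] := boolP (z \in <[r]>).
    by rewrite htau_r // (partition_mem_pblock _ pK).
  by apply: gl => //; [rewrite Gtau | case: (tau_refl Gz nz)].
rewrite (same_pblock tiK (st x Gx)) mem_pblockC // [in RHS]mem_pblockC //.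
by rewrite (same_pblock tiK (st y Gy)).
Qed.

Hypothesis unglued :
  {in G &, forall x y, x \notin <[r]> -> y \notin <[r]> -> y \in pblock K x ->
     is1 ord0 x = is1 ord0 y}.

Notation L i := (pblock K (refl i)).

(** The superclasses of reflections are the two classes, which tau exchanges; the others consist of
    rotations, which it fixes. *)
Lemma unmixed_tau :
    {in G &, forall x y, x \notin <[r]> -> y \in pblock K x -> y \notin <[r]>} ->
  sct_act tau (K, X) = (K, X).
Proof.
move=> um; apply: (sct_act_fixed hS) => // x y Gx Gy.
have um' z w : z \in G -> w \in G -> w \in pblock K z -> (w \in <[r]>) = (z \in <[r]>).
  move=> Gz Gw wz; apply/idP/idP; apply: contraLR => nr; first exact: um wz.
  by apply: (um _ _ Gw Gz nr); rewrite mem_pblockC.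
have notin z w : z \in G -> w \in G -> (w \in <[r]>) != (z \in <[r]>) ->
    w \in pblock K z = false.
  by move=> Gz Gw nzw; apply: contraNF nzw => /um' ->.
have [Rx|nx] := boolP (x \in <[r]>); have [Ry|ny] := boolP (y \in <[r]>).
- by rewrite !htau_r.
- have [nt _] := tau_refl Gy ny; rewrite (htau_r Rx).
  by rewrite !notin ?Gtau ?Rx ?(negPf ny) ?(negPf nt).
- have [nt _] := tau_refl Gx nx; rewrite (htau_r Ry).
  by rewrite !notin ?Gtau ?Ry ?(negPf nx) ?(negPf nt).
have [ntx etx] := tau_refl Gx nx; have [nty ety] := tau_refl Gy ny.
have blockE z w : z \in G -> w \in G -> z \notin <[r]> -> w \notin <[r]> ->
    (w \in pblock K z) = (is1 ord0 z == is1 ord0 w).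
  move=> Gz Gw nz nw; apply/idP/idP => [/(unglued Gz Gw nz nw)->|e]; first by [].
  by apply: (refl_pblock hS) => //; move: e; do 2!case: is1.
by rewrite !blockE ?Gtau // etx ety; do 2!case: is1.
Qed.

Hypothesis mixed : exists i a, a \in <[r]> /\ a \in L i.

Let pjK := merge K (L ord0) (L ord_max).
Let pjX := merge X (pblock X c0) (pblock X c1).

Let KL (i : 'I_2) : L i \in K. Proof. exact: (block_refl hS). Qed.
Let XL j : pblock X j \in X. Proof. by rewrite (partition_pblock pX) ?inE. Qed.

Let neqL : L ord0 != L ord_max.
Proof.
apply/eqP=> eL; have := block_refl_id hS ord0.
rewrite eL (block_reflE hS unglued) ?refl_mem ?dihedral_refl_notin //.
by rewrite is1_reflE.
Qed.

Let neqX : pblock X c0 != pblock X c1.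
Proof.
apply: contra (mu_separated hS unglued) => /eqP ->.
by rewrite (partition_mem_pblock _ pX) inE.
Qed.

Let mem_L x : x \in G -> x \notin <[r]> -> x \in L ord0 :|: L ord_max.
Proof.
move=> Gx nx; rewrite inE !(block_reflE hS unglued) // is1_neq //.
by case: is1.
Qed.

(** By [mixed] some [L i] contains a rotation. Tau fixes it but sends [refl i] to the other class,
    so the image of [L i] meets both [L ord0] and [L ord_max]. *)
Lemma join_blocks : partition_join K [set tau @: A | A : {set gT} in K] = pjK.
Proof.
apply: (partition_join_merge pK) => //; first 1 last.
  have [i [a [Ra La]]] := mixed.
  exists (tau @: L i); first exact: imset_f.
  have hi : ~~ [disjoint tau @: L i & L i].
    apply/pred0Pn; exists a; rewrite /= La andbT -(htau_r Ra); exact: imset_f.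
  have ti : tau (refl i) \in L (rev_ord i).
    have [nt et] := tau_refl (refl_mem i) (dihedral_refl_notin i).
    rewrite (block_reflE hS unglued) ?Gtau ?refl_mem // is1_rev ?Gtau ?refl_mem //.
    have : is1 ord0 (tau (refl i)) = (i != ord0) by rewrite et is1_reflE.
    have := is1_neq (etrans (Gtau _) (refl_mem i)) nt.
    by case: (ord2P i) => -> H E; rewrite ?H E.
  have hi' : ~~ [disjoint tau @: L i & L (rev_ord i)].
    apply/pred0Pn; exists (tau (refl i)); apply/andP; split=> //.
    by apply: imset_f; apply: (block_refl_id hS).
  case: (ord2P i) hi hi' => ->.
    by rewrite rev_ord_ord0 => -> ->.
  by rewrite rev_ord_ordmax => -> ->.
move=> _ /imsetP[A KA ->].
have sAG := subsetP (partition_sub pK KA).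
have [sAR|nsAR] := boolP (A \subset <[r]>).
  left; suffices -> : tau @: A = A by [].
  rewrite -[RHS]imset_id; apply: eq_in_imset => x Ax.
  by rewrite htau_r // (subsetP sAR).
right; have /subsetPn[x Ax nx] := nsAR.
have sA : A \subset L ord0 :|: L ord_max.
  have := mem_L (sAG x Ax) nx.
  by rewrite inE => /orP[] xL; rewrite -(partition_def_pblock pK KA Ax) (same_pblock tiK xL);
    rewrite ?subsetUl ?subsetUr.
apply/subsetP=> _ /imsetP[y Ay ->].
have [Ry|ny] := boolP (y \in <[r]>); first by rewrite htau_r // (subsetP sA).
have Gy := sAG y Ay; have [nt _] := tau_refl Gy ny.
by rewrite mem_L ?Gtau.
Qed.

(** When mu_i is alone in its part, the sigma of that part is mu_i itself. *)
Lemma is1_block (i : 'I_2) x y :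
    pblock X (mu i) = [set mu i] -> x \in G -> y \in pblock K x ->
  is1 i x = is1 i y.
Proof.
move=> Xi Gx yx; rewrite /is1.
have XY : [set mu i] \in X by rewrite -Xi.
have := sct_sigma_const hS XY Gx yx.
by rewrite /sigma !sum_cfunE !big_set1 !cfunE !mu1 !mul1r => ->.
Qed.

Variable i : 'I_2.
Hypothesis Xi : pblock X (mu i) = [set mu i].

Let Xid j : j \in pblock X j.
Proof. by rewrite (partition_mem_pblock _ pX) inE. Qed.

Let is1_L (j k : 'I_2) x :
  pblock X (mu k) = [set mu k] -> x \in L j -> is1 k x = (j == k).
Proof. by move=> Xk /(is1_block Xk (refl_mem j)) <-; rewrite is1_reflE. Qed.

(** Otherwise both mu_0 and mu_1 would be constant on the mixed superclass, but they differ at its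
    reflections and agree at its rotations. *)
Lemma other_part_mu : pblock X (mu (rev_ord i)) <> [set mu (rev_ord i)].
Proof.
move=> Xi'; have [j [a [Ra La]]] := mixed.
have Ga : a \in G by rewrite sRG.
have : is1 ord0 a == is1 ord_max a by rewrite -mem_cycle_is1.
have := is1_L Xi La; have := is1_L Xi' La.
by case: (ord2P i) => ->; case: (ord2P j) => ->;
  rewrite ?rev_ord_ord0 ?rev_ord_ordmax => -> ->.
Qed.

Let tperm_mu j : tperm c0 c1 (mu j) = mu (rev_ord j).
Proof.
by case: (ord2P j) => ->; rewrite ?tpermL ?tpermR ?rev_ord_ord0 ?rev_ord_ordmax.
Qed.

Lemma join_parts :
  partition_join X [set act_chars tau Y | Y : {set Iirr G} in X] = pjX.
Proof.
apply: (partition_join_merge pX) => //; first 1 last.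
  (* The transposition fixes [k] and sends [mu (rev_ord i)] to [mu i], so the image of their part
     meets both parts to be merged. *)
  have [k Xk nk] : exists2 k, k \in pblock X (mu (rev_ord i)) & k != mu (rev_ord i).
    apply/exists_inP; apply: contraT; rewrite negb_exists_in => /forall_inP hk.
    case: other_part_mu; apply/setP=> k; rewrite inE; apply/idP/eqP => [/hk|->].
      by rewrite negbK => /eqP.
    exact: Xid.
  have nki : k != mu i.
    apply: contraTneq Xk => ->; apply: (mu_separated2 hS unglued).
    by rewrite eq_sym ord2_neq.
  have ck : c0 != k /\ c1 != k.
    by move: nk nki; case: (ord2P i) => ->; rewrite ?rev_ord_ord0 ?rev_ord_ordmax => nk nki;
      rewrite eq_sym [c1 == k]eq_sym.
  have [tk0 tk1] : k \in act_chars tau (pblock X (mu (rev_ord i))) /\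
      mu i \in act_chars tau (pblock X (mu (rev_ord i))).
    by rewrite !mem_act_chars_tau tperm_mu Xid tpermD ?ck.1 ?ck.2.
  exists (act_chars tau (pblock X (mu (rev_ord i)))); first exact: imset_f.
  have h1 : ~~ [disjoint act_chars tau (pblock X (mu (rev_ord i))) & pblock X (mu i)].
    by apply/pred0Pn; exists (mu i); rewrite /= tk1 Xid.
  have h2 : ~~ [disjoint act_chars tau (pblock X (mu (rev_ord i))) & pblock X (mu (rev_ord i))].
    by apply/pred0Pn; exists k; rewrite /= tk0 Xk.
  case: (ord2P i) h1 h2 => ->.
    by rewrite rev_ord_ord0 => -> ->.
  by rewrite rev_ord_ordmax => -> ->.
move=> _ /imsetP[Y XY ->].
have [|/norP[nY0 nY1]] := boolP ((c0 \in Y) || (c1 \in Y)).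
  move=> Yc; right; apply/subsetP=> j; rewrite mem_act_chars_tau inE.
  case: tpermP => [-> _|-> _|_ _ Yj]; rewrite ?Xid ?orbT //.
  by case/orP: Yc => Yc; rewrite (partition_def_pblock pX XY Yc) Yj ?orbT.
left; suffices -> : act_chars tau Y = Y by [].
apply/setP=> j; rewrite mem_act_chars_tau.
by case: tpermP => [->|->|//]; rewrite (negPf nY0) (negPf nY1).
Qed.

(** One superclass and one part are lost. Each part now contains both of mu_0 and mu_1 or neither,
    so [sigma_refl] gives constancy on the merged superclass. *)
Lemma join_sct : is_sct (pjK, pjX).
Proof.
case: hS => [[_ cK] _ eKX K1 cS]; split.
- split; first exact: merge_partition.
  move=> A; rewrite mem_merge => /orP[/eqP-> | /and3P[_ _ /cK //]].
  have [C0 sC0 ->] := cK _ (KL ord0); have [C1 sC1 ->] := cK _ (KL ord_max).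
  by exists (C0 :|: C1); rewrite ?subUset ?sC0 // /cover bigcup_setU.
- exact: merge_partition.
- by apply: succn_inj; rewrite (card_merge pK) ?(card_merge pX).
- have n1 i0 : [set 1] != L i0.
    by apply: contraNneq (block_refl1 hS i0) => <-; rewrite set11.
  by rewrite mem_merge K1 !n1 orbT.
have sigmaU x : sigma (pblock X c0 :|: pblock X c1) x =
    (sigma (pblock X c0) x + sigma (pblock X c1) x)%R.
  have /and3P[_ /trivIsetP tX _] := pX.
  rewrite /sigma !sum_cfunE -bigU /=; last exact: tX (XL c0) (XL c1) neqX.
  by apply: eq_bigl => j; rewrite !inE.
have Yc Y : Y \in pjX -> (c0 \in Y) = (c1 \in Y).
  rewrite mem_merge => /orP[/eqP-> | /and3P[n0 n1 XY]]; first by rewrite !inE !Xid orbT.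
  have nY j : Y != pblock X j -> j \in Y = false.
    by apply: contraNF => /(partition_def_pblock pX XY) ->.
  by rewrite !nY.
have cY Y A : Y \in pjX -> A \in K -> {in A &, forall g h, sigma Y g = sigma Y h}.
  rewrite mem_merge => /orP[/eqP-> | /and3P[_ _ XY]] KA g h Ag Ah; last exact: cS XY A KA g h Ag Ah.
  by rewrite !sigmaU; congr (_ + _)%R; apply: cS KA _ _ Ag Ah.
move=> Y pY A; rewrite mem_merge => /orP[/eqP-> | /and3P[_ _ KA]]; last exact: cY.
suffices key x : x \in L ord0 :|: L ord_max -> sigma Y x = sigma Y (refl ord0).
  by move=> x y /key-> /key->.
have ref j : sigma Y (refl j) = sigma Y (refl ord0).
  by apply: sigma_refl; rewrite ?refl_mem ?dihedral_refl_notin ?Yc.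
by case/setUP=> xL; apply: etrans (ref _); apply: (cY Y _ pY (KL _)) xL _;
  apply: block_refl_id hS _.
Qed.

Let memU x : x \in L ord0 :|: L ord_max -> pblock pjK x = L ord0 :|: L ord_max.
Proof. exact: pblock_mergeU pK (KL _) (KL _) neqL x. Qed.

Lemma join_glued :
  {in G &, forall x y, x \notin <[r]> -> y \notin <[r]> -> y \in pblock pjK x}.
Proof. by move=> x y Gx Gy nx ny; rewrite memU ?mem_L. Qed.

Lemma rot_order2 x : n = 2 -> x \in <[r]> -> x != 1 -> x = r.
Proof.
move=> n2; have [_ _ rn _ _] := hG; rewrite n2 in rn; case/cycleP=> k ->.
rewrite -[k]odd_double_half -mul2n expgD expgM rn expg1n mulg1.
by case: (odd k); rewrite ?expg1 ?expg0 ?eqxx.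
Qed.

Lemma join_characteristic : characteristic_sct (pjK, pjX).
Proof.
have [n2|nn2] := eqVneq n 2; last first.
  apply: (glued_characteristic join_sct); last exact: join_glued.
  by move: n_gt0 n_even nn2; case: (n) => [|[|[|]]].
(* For n = 2 the only nontrivial rotation is r, which [mixed] puts in the merged superclass; the
   superclasses are then {1} and its complement. *)
apply: (sct_characteristic join_sct) => a AutGa x y Gx Gy.
have pJ : partition pjK G by case: join_sct => [[]].
have J1 : [set 1] \in pjK by case: join_sct.
have a1 : a 1 = 1 by rewrite -(autmE AutGa) morph1.
have big z : z \in G -> z != 1 -> z \in L ord0 :|: L ord_max.
  move=> Gz z1; have [Rz|nz] := boolP (z \in <[r]>); last exact: mem_L.
  have [j [b [Rb Lb]]] := mixed.
  have nb : b != 1 by apply: contraNneq (block_refl1 hS j) => <-.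
  have <- : b = z by rewrite (rot_order2 n2 Rz z1) (rot_order2 n2 Rb nb).
  rewrite inE.
  by case: (ord2P j) Lb => -> ->; rewrite ?orbT.
have [->|x1] := eqVneq x 1.
  rewrite (partition_def_pblock pJ J1 (set11 _)) inE => /eqP ->.
  by rewrite a1 (partition_mem_pblock _ pJ) group1.
move=> yx; have y1 : y != 1.
  apply: contraNneq x1 => y1; have /and3P[_ tiJ _] := pJ.
  move: yx; rewrite y1 mem_pblockC // (partition_def_pblock pJ J1 (set11 _)).
  by rewrite inE.
have a_neq1 z : z != 1 -> a z != 1 by rewrite -{2}a1 (inj_eq perm_inj).
by rewrite memU ?big ?a_neq1 // Aut_mem.
Qed.

Lemma join_in_R : in_R r s (pjK, pjX).
Proof.
split; [exact: join_sct | exact: join_characteristic | |] => /=.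
  exists (L ord0 :|: L ord_max); first by rewrite mem_merge eqxx.
  apply/subsetP=> x; rewrite mem_lcoset => Rx; apply: mem_L.
    by rewrite -(groupMl _ (groupVr Gs)) sRG.
  by apply: contra dihedral_s_notin => rx; rewrite -groupV -(groupMr _ rx).
(* A superclass of rotations is not the merged one, so it belongs to K, and mu_i, constant on it,
   gives the parity. *)
move=> A pA sAR k l Ak Al; move: pA; rewrite mem_merge => /orP[/eqP eA | /and3P[_ _ KA]].
  case/negP: (dihedral_refl_notin (ord0 : 'I_2)); apply: (subsetP sAR).
  by rewrite eA mem_L ?refl_mem ?dihedral_refl_notin.
have Rk m : r ^+ m \in G by rewrite groupX.
have : r ^+ l \in pblock K (r ^+ k) by rewrite (partition_def_pblock pK KA Ak).
by move/(is1_block Xi (Rk k)); rewrite !is1_rot => /(can_inj negbK).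
Qed.

(** The two superclasses are recovered from their union: mu_i is 1 on [L i] and -1 on the other, so
    the rotations of [L i] are even and those of the other odd. *)
Lemma eq_psi : (K, X) = psi r s mu i (pjK, pjX).
Proof.
rewrite /psi /=.
have -> : pblock pjK s = L ord0 :|: L ord_max.
  by rewrite memU // mem_L // dihedral_s_notin.
have -> : pblock pjX c0 = pblock X c0 :|: pblock X c1.
  by apply: (pblock_mergeU pX) => //; rewrite inE Xid.
rewrite (mergeD1U _ pK) // (mergeD1U _ pX) //.
have split2 (T : finType) (P : {set {set T}}) (A B : {set T}) :
    A \in P -> B \in P -> [set A; B] :|: (P :\ A :\ B) = P.
  move=> PA PB; apply/setP=> C; rewrite !inE.
  by case: eqVneq => [->|_]; case: eqVneq => [->|_]; rewrite ?PA ?PB.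
congr pair.
  rewrite -[LHS](split2 _ _ _ _ (KL ord0) (KL ord_max)); congr (_ :|: _).
  have outside (y : gT) x : y \in G -> x \notin G -> x \in y *: <[r ^+ 2]> = false.
    move=> Gy; apply: contraNF; rewrite mem_lcoset => /sEr/sRG.
    by rewrite groupMl ?groupV.
  have nL j x : x \notin G -> x \in L j = false.
    by apply: contraNF; apply: (subsetP (partition_sub pK (KL j))).
  have inL x : x \in G ->
      [/\ x \in L ord0 -> is1 i x = (ord0 == i), x \in L ord_max -> is1 i x = (ord_max == i)
        & is1 ord0 x != is1 ord_max x ->
          (x \in L ord0 = is1 ord0 x) * (x \in L ord_max = is1 ord_max x)].
    move=> Gx; split; [exact: is1_L | exact: is1_L | rewrite -mem_cycle_is1 // => nx].
    by rewrite !(block_reflE hS unglued).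
  move: (nL ord0) (nL ord_max) inL; move: (L ord0) (L ord_max) => L0 L1 nL0 nL1 inL.
  congr [set _; _]; apply/setP=> x.
  - have [Gx|nx] := boolP (x \in G); last first.
      by rewrite !inE nL0 // outside //; case: (i == ord0); rewrite /= !inE nL0 // nL1.
    have [] := inL x Gx.
    case: (ord2P i) => -> /=; rewrite !inE mem_refl0 // ?mem_even_rot ?mem_odd_rot //;
      case: (x \in L0); case: (x \in L1); case: (is1 ord0 x); case: (is1 ord_max x) => //= h0 h1 h;
      do ?[by have := h0 isT | by have := h1 isT | by case: (h isT)].
  - have [Gx|nx] := boolP (x \in G); last first.
      by rewrite !inE nL1 // outside ?groupM //; case: (i == ord0); rewrite /= !inE nL0 // nL1.
    have [] := inL x Gx.
    case: (ord2P i) => -> /=; rewrite !inE mem_refl1 // ?mem_even_rot ?mem_odd_rot //;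
      case: (x \in L0); case: (x \in L1); case: (is1 ord0 x); case: (is1 ord_max x) => //= h0 h1 h;
      do ?[by have := h0 isT | by have := h1 isT | by case: (h isT)].
rewrite -[LHS](split2 _ _ _ _ (XL c0) (XL c1)); congr (_ :|: _).
have dX : pblock X (mu (rev_ord i)) =
    (pblock X c0 :|: pblock X c1) :\ mu i.
  have -> : pblock X c0 :|: pblock X c1 = mu i |: pblock X (mu (rev_ord i)).
    rewrite -Xi; case: (ord2P i) => ->; rewrite ?rev_ord_ord0 ?rev_ord_ordmax //.
    by rewrite setUC.
  rewrite setU1K //; apply: (mu_separated2 hS unglued).
  by rewrite eq_sym ord2_neq.
rewrite -dX -Xi; case: (ord2P i) => ->; rewrite ?rev_ord_ord0 ?rev_ord_ordmax //.
by rewrite setUC.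
Qed.

End Blocks.

End Tau.

End Dihedral.

(* The hypothesis hKlein only concerns n = 2, where G is the Klein four-group.
   It excludes the theory with superclasses {e}, {r}, {s, sr}, for which the
   conclusion fails: it is tau-invariant, but not characteristic. *)
Theorem theorem4p2 (n : nat) (n_gt0 : (0 < n)%N) (n_even : ~~ odd n)
    (gT : finGroupType) (G : {group gT}) (r s : gT)
    (hG : dihedral_gens G n r s)
    (mu : 'I_2 -> Iirr G) (hmu : is_mu r s mu)
    (tau : {perm gT}) (htau : tau \in Aut G)
    (htau_s : tau s = s * r) (htau_r : forall x, x \in <[r]> -> tau x = x)
    (S : sct_data G) (hS : is_sct S) (hSnc : ~ characteristic_sct S)
    (hKlein : n = 2 -> sct_act tau S <> S) :
  in_R r s (sct_join S (sct_act tau S)) /\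
  exists i : 'I_2, S = psi r s mu i (sct_join S (sct_act tau S)).
Proof.
case: S hS hSnc hKlein => K X hS hSnc hKlein.
have [[pK _] pX _ _ _] := hS; have /and3P[_ tiK _] := pK.
have n_gt2 : n <> 2 -> 2 < n by move: n_gt0 n_even; case: (n) => [|[|[|]]].
(* Each case to be excluded ends here: against [hSnc] for n > 2, against [hKlein] for n = 2. *)
have not_fixed : sct_act tau (K, X) = (K, X) -> (2 < n -> characteristic_sct (K, X)) -> False.
  move=> fix_tau char_S; have [n2|/eqP/n_gt2/char_S //] := eqVneq n 2.
  exact: hKlein n2 fix_tau.
have unglued : {in G &, forall x y, x \notin <[r]> -> y \notin <[r]> ->
    y \in pblock K x -> is1 mu ord0 x = is1 mu ord0 y}.
  move=> x y Gx Gy nx ny yx; have [//|nxy] := eqVneq (is1 mu ord0 x) (is1 mu ord0 y).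
  have glued := glued_refl n_gt0 hG hmu hS Gx Gy nx ny yx nxy.
  case: not_fixed; first exact: (glued_tau n_gt0 hG hmu htau htau_s htau_r hS).
  by move=> n2; apply: (glued_characteristic n_gt0 hG n_even hS).
have mixed : exists (i : 'I_2) a, a \in <[r]> /\ a \in pblock K (s * r ^+ i).
  suffices /existsP[i /exists_inP[a Ra La]] : [exists i : 'I_2, exists a in <[r]>,
      a \in pblock K (s * r ^+ i)] by exists i, a.
  apply: contraT => nmixed.
  have um : {in G &, forall x y, x \notin <[r]> -> y \in pblock K x -> y \notin <[r]>}.
    move=> x y Gx Gy nx yx; apply: contra nmixed => Ry; apply/existsP.
    have [i ix] : exists i, is1 mu i x.
      have := is1_neq n_gt0 hG hmu Gx nx; case: (boolP (is1 mu ord0 x)); first by exists ord0.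
      by exists ord_max.
    exists i; apply/exists_inP; exists y => //; rewrite -(same_pblock tiK (x := x)) //.
    by rewrite (block_reflE n_gt0 hG hmu hS unglued).
  case: not_fixed.
    exact: (unmixed_tau n_gt0 hG hmu htau htau_s htau_r hS unglued um).
  by move=> n2; apply: (unmixed_characteristic n_gt0 hG n_even hmu hS n2 um unglued).
have [i Xi] := part_mu n_gt0 hG n_even hmu hS unglued.
have -> : sct_join (K, X) (sct_act tau (K, X)) =
    (merge K (pblock K (s * r ^+ (ord0 : 'I_2))) (pblock K (s * r ^+ (ord_max : 'I_2))),
     merge X (pblock X (mu ord0)) (pblock X (mu ord_max))).
  congr pair; first exact: (join_blocks n_gt0 hG hmu htau htau_s htau_r hS unglued mixed).
  exact: (join_parts n_gt0 hG n_even hmu htau htau_s htau_r hS unglued mixed Xi).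
split; first exact: (join_in_R n_gt0 hG n_even hmu hS unglued mixed Xi).
by exists i; apply: (eq_psi n_gt0 hG n_even hmu hS unglued Xi).
Qed.
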